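(* Let $r\ge 1$ and $c_1,\dots,c_r\in\{0,1\}$, $\mathbf c=(c_1,\dots,c_r)$. Then the limit $\rho^r(\mathbf c,2)=\lim_{Q\to\infty}\rho^r_Q(\mathbf c,2)$ exists. Moreover, $\rho^1(0;2)=1/3$, $\rho^1(1;2)=2/3$, $\rho^2(0,1;2)=\rho^2(1,0;2)=\rho^2(1,1;2)=1/3$, and for $r\ge 3$, $$\rho^r(\mathbf c,2)=\frac23\sum_{\mathbf k\in\mathcal K^{r-2}(\mathbf c,2)}\mathrm{Area}\big(\mathcal T[\mathbf k]\big).$$
   Context: For a positive integer $Q$, the Farey sequence $\mathfrak F_Q$ is the increasing sequence of reduced fractions $a/q\in[0,1]$ with $1\le q\le Q$. For $\mathbf c=(c_1,\dots,c_r)$ with $0\le c_j\le d-1$, let $N^r_Q(\mathbf c,d)$ be the number of $r$-tuples of denominators $(q_1,\dots,q_r)$ of $r$ consecutive elements of $\mathfrak F_Q$ with $q_j\equiv c_j\pmod d$ for all $j$, and $\rho^r_Q(\mathbf c,d)=N^r_Q(\mathbf c,d)/(\#\mathfrak F_Q-(r-1))$; for $r=1,2$ we write e.g. $\rho^1(c_1;d)$, $\rho^2(c_1,c_2;d)$ for the limits. Let $\mathcal T=\{(x,y)\in\mathbb R^2:0<x\le1,\ 0<y\le 1,\ x+y>1\}$ and $\mathcal T_Q=Q\mathcal T$. For $(x,y)\in\mathcal T$ define $L_{-1}=x$, $L_0=y$ and for $j\ge1$, $L_j=\left\lfloor\frac{1+L_{j-2}}{L_{j-1}}\right\rfloor L_{j-1}-L_{j-2}$,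 and $k_j(x,y)=\left\lfloor\frac{1+L_{j-2}}{L_{j-1}}\right\rfloor$. For $\mathbf k\in(\mathbb N^* )^s$ put $\mathcal T[\mathbf k]=\{(x,y)\in\mathcal T:(k_1(x,y),\dots,k_s(x,y))=\mathbf k\}$. For $Q\ge1$ and a lattice point $(q',q'')\in\mathcal T_Q$ with $\gcd(q',q'')=1$, define $q_1=q'$, $q_2=q''$, and recursively $k_j=\lfloor (Q+q_j)/q_{j+1}\rfloor$, $q_{j+2}=k_jq_{j+1}-q_j$; set $\mathbf q(q',q'')=(q_1,\dots,q_r)$ and $\mathbf k(q',q'')=(k_1,\dots,k_{r-2})$. The set $\mathcal A^{s}$ of admissible vectors consists of all $\mathbf k\in(\mathbb N^* )^s$ of the form $\mathbf k(q',q'')$ for some $Q\ge 1$ and some coprime lattice point $(q',q'')\in\mathcal T_Q$. Finally, $\mathcal K^{r-2}(\mathbf c,d)$ is the set of $\mathbf k\in\mathcal A^{r-2}$ for which there exist $Q\ge1$ and a lattice point $(q',q'')\in\mathcal T_Q$ with $\gcd(q',q'')=1$, $\mathbf k(q',q'')=\mathbf k$ and $\mathbf q(q',q'')\equiv\mathbf c\pmod d$ componentwise. *)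

(* Defs.v *)
From HB Require Import structures.
From mathcomp Require Import all_boot all_order all_algebra.
From mathcomp Require Import all_classical all_reals all_analysis.

Set Implicit Arguments.
Unset Strict Implicit.
Unset Printing Implicit Defensive.
Import Order.TTheory GRing.Theory Num.Theory.
Import numFieldNormedType.Exports.
Local Open Scope classical_set_scope.
Local Open Scope ring_scope.

Definition farey (Q : nat) : seq rat :=
  sort <=%R [seq a%:R / q%:R | q <- iota 1 Q, a <- [seq a <- iota 0 q.+1 | coprime a q]].

Definition farey_den (Q : nat) : seq nat := [seq `|denq x|%N | x <- farey Q].

Definition congr_mod (d r : nat) (q : nat -> nat) (c : r.-tuple nat) : Prop :=
  forall j : 'I_r, q j = tnth c j %[mod d].

(* The r-tuples are counted by the position i at which they start: for r = 1
   the same denominator occurs several times. *)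
Definition farey_count (Q r : nat) (c : r.-tuple nat) (d : nat) : nat :=
  count (fun i => `[< congr_mod d (fun j => nth 0%N (farey_den Q) (i + j)) c >])
        (iota 0 (size (farey Q) - (r - 1))).

Definition rhoQ (R : realType) (r : nat) (c : r.-tuple nat) (d Q : nat) : R :=
  (farey_count Q c d)%:R / ((size (farey Q))%:R - (r%:R - 1)).

(* Meaningful only when the sequence converges. *)
Definition rho (R : realType) (r : nat) (c : r.-tuple nat) (d : nat) : R :=
  limn (rhoQ R c d).

Definition fareyT (R : realType) : set (R * R) :=
  [set p | [/\ 0 < p.1 <= 1, 0 < p.2 <= 1 & 1 < p.1 + p.2]].

(* Indices are shifted by one: [Lseq p n] is L_{n-1}(p). *)
Fixpoint Lseq (R : realType) (p : R * R) (n : nat) : R :=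
  match n with
  | 0 => p.1
  | n1.+1 =>
    match n1 with
    | 0 => p.2
    | n2.+1 => (Num.floor ((1 + Lseq p n2) / Lseq p n1))%:~R * Lseq p n1 - Lseq p n2
    end
  end.

(* [kidx p j] is k_{j+1}(p). *)
Definition kidx (R : realType) (p : R * R) (j : nat) : int :=
  Num.floor ((1 + Lseq p j) / Lseq p j.+1).

Definition fareyTk (R : realType) (s : nat) (k : s.-tuple nat) : set (R * R) :=
  [set p | fareyT p /\ forall j : 'I_s, kidx p j = (tnth k j)%:Z].

Arguments fareyTk R {s} k.

Definition area (R : realType) (A : set (R * R)) : \bar R :=
  (@lebesgue_measure R \x @lebesgue_measure R)%E A.

Definition lattice_pt (Q q' q'' : nat) : Prop :=
  [/\ (0 < q' <= Q)%N, (0 < q'' <= Q)%N, (Q < q' + q'')%N & coprime q' q''].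

(* [qseq Q q' q'' j] is q_{j+1}. On lattice points of T_Q the truncated
   subtraction is exact, as k_j q_{j+1} > Q + q_j - q_{j+1} >= q_j. *)
Fixpoint qseq (Q q' q'' : nat) (n : nat) : nat :=
  match n with
  | 0 => q'
  | n1.+1 =>
    match n1 with
    | 0 => q''
    | n2.+1 => ((Q + qseq Q q' q'' n2) %/ qseq Q q' q'' n1) * qseq Q q' q'' n1
               - qseq Q q' q'' n2
    end
  end%N.

(* [kseq Q q' q'' j] is k_{j+1}. *)
Definition kseq (Q q' q'' : nat) (j : nat) : nat :=
  ((Q + qseq Q q' q'' j) %/ qseq Q q' q'' j.+1)%N.

Definition has_kvec (s : nat) (Q q' q'' : nat) (k : s.-tuple nat) : Prop :=
  forall j : 'I_s, kseq Q q' q'' j = tnth k j.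

Definition admissible (s : nat) : set (s.-tuple nat) :=
  [set k | (forall j, (0 < tnth k j)%N) /\
     exists Q q' q'' : nat,
       [/\ (1 <= Q)%N, lattice_pt Q q' q'' & has_kvec Q q' q'' k]].

Definition Kset (r : nat) (c : r.-tuple nat) (d : nat) : set ((r - 2).-tuple nat) :=
  [set k | admissible k /\
     exists Q q' q'' : nat,
       [/\ (1 <= Q)%N, lattice_pt Q q' q'', has_kvec Q q' q'' k &
           congr_mod d (qseq Q q' q'') c]].

(* Main.v *)
(* Consecutive denominators in the Farey sequence of order Q are exactly the
   coprime lattice points of Q T, each occurring once, and the following
   denominators are obtained by iterating the map that defines the indices k_j.
   Modulo 2 the whole r-tuple is determined by k and by the parities of the
   first two denominators; so the tuples congruent to c are the coprime points
   of Q A with prescribed parities, where A is the union of the T[k] for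
   k in K(c, 2).

   Sieving by z! and letting z tend to infinity shows that, for every dyadic
   square S, asymptotically kappa * area(S) * Q^2 coprime points of a given
   parity class lie in Q S.  The constant kappa is the same for the three
   classes other than (even, even), because GL_2(Z) permutes them, and it is
   positive; its value cancels in the quotient by the number 3 kappa / 2 * Q^2
   of all pairs.

   Finitely additive set functions that converge on dyadic squares converge on
   every set with negligible boundary.  The boundary of A is negligible: at a
   point p of T on none of the countably many lines a x + b y = 1 with integers
   a and b, no quotient (1 + L_(j-2)) / L_(j-1) is an integer, so that the
   indices k_j are constant near p. *)

Require Import Defs.
From mathcomp Require Import all_boot all_order all_algebra.
From mathcomp Require Import all_classical all_reals all_analysis.
From mathcomp Require Import measurable_realfun.
From mathcomp Require Import zify ring lra.

Set Implicit Arguments.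
Unset Strict Implicit.
Unset Printing Implicit Defensive.
Import Order.TTheory GRing.Theory Num.Theory.
Import numFieldNormedType.Exports.
Local Open Scope classical_set_scope.
Local Open Scope ring_scope.

(** * Limits of sequences *)

Section SequenceLimits.
Variable R : realType.
Implicit Types x : nat -> R.

Lemma cvg_div_linear_growth x (c C : R) :
  (forall n, `|x n - c * n%:R| <= C) -> x n / n%:R @[n --> \oo] --> c.
Proof.
move=> growth; apply/cvgrPdist_le => e e0; near=> n.
have n0 : 0 < n%:R :> R by rewrite ltr0n; near: n; exact: nbhs_infty_gt.
have -> : c - x n / n%:R = - (x n - c * n%:R) / n%:R by field; rewrite gt_eqF.
rewrite normrM normrN normfV (gtr0_norm n0) ler_pdivrMr //.
apply: le_trans (growth n) _; rewrite mulrC -ler_pdivrMr //.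
near: n; exact: nbhs_infty_ger.
Unshelve. all: by end_near. Qed.

Lemma cvg_div_sqr_bounded x (C : R) :
  (forall n, `|x n| <= C) -> x n / n%:R ^+ 2 @[n --> \oo] --> (0 : R).
Proof.
move=> x_le; rewrite -(mul0r (0 : R)).
under eq_cvg do rewrite -[x _]mulr1 expr2 invfM mulrACA.
apply: cvgM; apply: cvg_div_linear_growth => n; first by rewrite mul0r subr0.
by rewrite mul0r subr0.
Qed.

Lemma cvgn_sum (I : Type) (s : seq I) (P : pred I) (x : I -> nat -> R) (l : I -> R) :
  (forall i, P i -> x i n @[n --> \oo] --> l i) ->
  \sum_(i <- s | P i) x i n @[n --> \oo] --> \sum_(i <- s | P i) l i.
Proof. by move=> xl; apply: cvg_big => // y; exact: add_continuous. Qed.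

Lemma cvg_uniform_approx x (y : nat -> nat -> R) (l w : nat -> R) :
  (forall z, y z n @[n --> \oo] --> l z) -> (forall z n, `|x n - y z n| <= w z) ->
  w z @[z --> \oo] --> (0 : R) ->
  exists L : R, l z @[z --> \oo] --> L /\ x n @[n --> \oo] --> L.
Proof.
move=> yl xy w0; apply: (cvg_switch _ _ _ yl).
apply/cvg_fct_entourageP => A; rewrite -entourage_ballE => -[e /= e0 ballA].
rewrite !near_simpl; near=> z => n; apply: ballA; apply: le_lt_trans (xy z n) _.
by near: z; exact: cvgr_lt w0 _ e0.
Unshelve. all: by end_near. Qed.

End SequenceLimits.

(** * Counting lattice points in boxes *)

Definition lattice_count (Q : nat) (S : rel nat) : nat :=
  (\sum_(p : 'I_Q.+1 * 'I_Q.+1) S p.1 p.2)%N.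

Section LatticeCount.
Variable Q : nat.
Implicit Types S T : rel nat.

Lemma lattice_countE S :
  lattice_count Q S = (\sum_(a < Q.+1) \sum_(b < Q.+1) S a b)%N.
Proof. by rewrite /lattice_count pair_bigA. Qed.

Lemma eq_lattice_count S T :
  (forall a b, (a <= Q)%N -> (b <= Q)%N -> S a b = T a b) ->
  lattice_count Q S = lattice_count Q T.
Proof. by move=> ST; apply: eq_bigr => -[a b] _ /=; rewrite ST -1?ltnS. Qed.

Lemma leq_lattice_countU S T1 T2 :
  (forall a b, (a <= Q)%N -> (b <= Q)%N -> S a b -> T1 a b || T2 a b) ->
  (lattice_count Q S <= lattice_count Q T1 + lattice_count Q T2)%N.
Proof.
move=> ST; rewrite /lattice_count -big_split; apply: leq_sum => -[a b] _ /=.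
have := ST a b (ltn_ord a) (ltn_ord b).
by case: (S a b) (T1 a b) (T2 a b) => [] [] [] // /(_ isT).
Qed.

Lemma lattice_count0 S :
  (forall a b, (a <= Q)%N -> (b <= Q)%N -> ~~ S a b) -> lattice_count Q S = 0%N.
Proof.
move=> S0; rewrite /lattice_count big1 // => -[a b] _ /=.
by rewrite (negbTE (S0 _ _ _ _)) -1?ltnS.
Qed.

Lemma leq_lattice_count S T :
  (forall a b, (a <= Q)%N -> (b <= Q)%N -> S a b -> T a b) ->
  (lattice_count Q S <= lattice_count Q T)%N.
Proof.
move=> ST; rewrite -[leqRHS]addn0 -(@lattice_count0 [rel _ _ | false]) //.
by apply: leq_lattice_countU => a b aQ bQ /(ST _ _ aQ bQ) ->.
Qed.

Lemma lattice_count_seq S (s : seq (nat * nat)) : uniq s ->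
  (forall a b, ((a, b) \in s) = [&& (a <= Q)%N, (b <= Q)%N & S a b]) ->
  lattice_count Q S = size s.
Proof.
move=> s_uniq mem_s.
pose nats (p : 'I_Q.+1 * 'I_Q.+1) : nat * nat := (p.1 : nat, p.2 : nat).
have nats_inj : injective nats by move=> [a b] [c d] [/val_inj -> /val_inj ->].
rewrite /lattice_count -big_mkcond sum1_card cardE -(size_map nats).
apply/perm_size/uniq_perm => //.
  by rewrite map_inj_uniq ?enum_uniq.
move=> [a b]; rewrite mem_s; apply/mapP/and3P => [[[i j]]|[]].
  by rewrite mem_enum => Sij [-> ->]; split=> //; rewrite -ltnS ltn_ord.
rewrite -!(ltnS _ Q) => aQ bQ Sab.
by exists (Ordinal aQ, Ordinal bQ); rewrite ?mem_enum.
Qed.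

End LatticeCount.

Definition lattice_density (R : realType) (Q : nat) (S : rel nat) : R :=
  (lattice_count Q S)%:R / Q%:R ^+ 2.

(** * Periodic relations *)

Definition periodic_mod (M : nat) (f : rel nat) : Prop :=
  forall a b, f (a %% M)%N (b %% M)%N = f a b.

Lemma periodic_mod_muln M N f : periodic_mod M f -> periodic_mod (M * N)%N f.
Proof.
by move=> fM a b; rewrite -fM !(modn_dvdm _ (dvdn_mulr N (dvdnn M))) fM.
Qed.

Definition residue_count (P : pred nat) (M u Q : nat) : nat :=
  (\sum_(a < Q.+1) (P a && (a %% M == u)))%N.

Lemma lattice_count_periodic (P1 P2 : pred nat) M (f : rel nat) Q :
  (0 < M)%N -> periodic_mod M f ->
  lattice_count Q [rel a b | [&& P1 a, P2 b & f a b]] =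
  (\sum_(p : 'I_M * 'I_M)
     f p.1 p.2 * (residue_count P1 M p.1 Q * residue_count P2 M p.2 Q))%N.
Proof.
move=> M0 fM; under eq_bigr => p _.
  rewrite big_distrlr big_distrr /=.
  under eq_bigr do rewrite big_distrr /=.
  over.
rewrite exchange_big lattice_countE /=; apply: eq_bigr => a _.
rewrite exchange_big /=; apply: eq_bigr => b _.
rewrite (bigD1 (Ordinal (ltn_pmod a M0), Ordinal (ltn_pmod b M0))) //= !eqxx fM.
rewrite big1 ?addn0 => [|[u v] /= uv]; first by case: (P1 a) (P2 b) (f a b) => [] [] [].
have [au|_] := (a %% M =P u)%N; last by rewrite andbF muln0.
have [bv|_] := (b %% M =P v)%N; last by rewrite andbF !muln0.
by case/eqP: uv; congr (_, _); exact/val_inj.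
Qed.

Lemma count_modn M u n : (u < M)%N ->
  (\sum_(a < n) (a %% M == u))%N = ((n + (M - u.+1)) %/ M)%N.
Proof.
move=> uM; elim: n => [|n IHn]; first by rewrite big_ord0 divn_small //; lia.
rewrite big_ord_recr /= IHn addSn divnS 1?addnC; last by lia.
congr (nat_of_bool _ + _)%N.
have -> : (n + (M - u.+1)).+1 = (n + M - u)%N by lia.
by rewrite -eqn_mod_dvd ?modnDr ?(modn_small uM) //; lia.
Qed.

(** * Boxes of side Q / D *)

(* [a / Q] lies in the interval ]i / D, (i + 1) / D]. *)
Definition cell (D i Q a : nat) : bool := (i * Q < a * D <= i.+1 * Q)%N.

Definition in_box (D i j Q : nat) : rel nat := [rel a b | cell D i Q a && cell D j Q b].

Lemma residue_count_le D M u i Q : (0 < D)%N -> (u < M)%N -> (i <= D)%N ->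
  residue_count (fun a => a * D <= i * Q)%N M u Q =
  ((i * Q %/ D + (M - u)) %/ M)%N.
Proof.
move=> D0 uM iD; have iQ_lt : ((i * Q %/ D).+1 <= Q.+1)%N.
  by rewrite ltnS -{2}(mulKn Q D0) leq_div2r // leq_mul2r iD orbT.
transitivity (\sum_(a < (i * Q %/ D).+1) (a %% M == u))%N.
  rewrite (big_ord_widen_cond _ xpredT (fun a => (a %% M == u)%N : nat) iQ_lt).
  rewrite [RHS]big_mkcond; apply: eq_bigr => a _ /=.
  by rewrite ltnS leq_divRL //; case: leqP.
by rewrite count_modn //; congr (_ %/ _)%N; lia.
Qed.

Lemma residue_count_cell D M u i Q :
  (residue_count (cell D i Q) M u Q + residue_count (fun a => a * D <= i * Q)%N M u Q =
   residue_count (fun a => a * D <= i.+1 * Q)%N M u Q)%N.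
Proof.
rewrite -big_split; apply: eq_bigr => a _ /=; rewrite /cell ltnNge mulSn.
by case: leqP => [aD|_] /=; rewrite ?addn0 ?(leq_trans aD) ?leq_addl.
Qed.

Section ResidueDensity.
Variable R : realType.

Definition residue_density (M : nat) (f : rel nat) : R :=
  (\sum_(p : 'I_M * 'I_M) f p.1 p.2)%N%:R / M%:R ^+ 2.

Lemma cvg_residue_count_le D M u i : (0 < D)%N -> (u < M)%N -> (i <= D)%N ->
  (residue_count (fun a => a * D <= i * Q)%N M u Q)%:R / Q%:R @[Q --> \oo] -->
  (i%:R / (D * M)%:R : R).
Proof.
move=> D0 uM iD; apply: (@cvg_div_linear_growth _ _ _ 1) => Q.
rewrite residue_count_le //; set w := (_ %/ D)%N; set t := (_ %/ M)%N.
have M0 : (0 < M)%N by lia.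
have [tDM_le le_tDM] : (t * (D * M) <= i * Q + D * M)%N /\ (i * Q <= t * (D * M) + D * M)%N.
  have := (leq_trunc_div (i * Q) D, ltn_ceil (i * Q) D0).
  have := (leq_trunc_div (w + (M - u)) M, ltn_ceil (w + (M - u)) M0).
  by rewrite -/w -/t => -[? ?] [? ?]; nia.
have DM0 : 0 < (D * M)%:R :> R by rewrite ltr0n; nia.
rewrite -(ler_pM2r DM0) mul1r -[X in _ * X <= _](gtr0_norm DM0) -normrM.
have -> : (t%:R - i%:R / (D * M)%:R * Q%:R) * (D * M)%:R =
    (t * (D * M))%:R - (i * Q)%:R :> R.
  by rewrite !natrM; field; rewrite !pnatr_eq0 -!lt0n D0 M0.
by rewrite ler_distl lerBlDr -!natrD !ler_nat le_tDM.
Qed.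

Lemma cvg_residue_count_cell D M u i : (0 < D)%N -> (u < M)%N -> (i < D)%N ->
  (residue_count (cell D i Q) M u Q)%:R / Q%:R @[Q --> \oo] --> ((D * M)%:R^-1 : R).
Proof.
move=> D0 uM iD.
have -> : (D * M)%:R^-1 = i.+1%:R / (D * M)%:R - i%:R / (D * M)%:R :> R.
  by rewrite -mulrBl -natrB // subSnn mul1r.
under eq_cvg => Q do
  rewrite -[_%:R](addrK (residue_count (fun a => a * D <= i * Q)%N M u Q)%:R)
    -natrD residue_count_cell mulrBl.
by apply: cvgB; apply: cvg_residue_count_le => //; exact: ltnW.
Qed.

Lemma cvg_box_residue_density D M i j f :
  (0 < D)%N -> (i < D)%N -> (j < D)%N -> (0 < M)%N -> periodic_mod M f ->
  lattice_density R Q [rel a b | in_box D i j Q a b && f a b] @[Q --> \oo] -->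
  residue_density M f / D%:R ^+ 2.
Proof.
move=> D0 iD jD M0 fM.
have -> : residue_density M f / D%:R ^+ 2 = \sum_(p : 'I_M * 'I_M)
    (f p.1 p.2)%:R * ((D * M)%:R^-1 * (D * M)%:R^-1) :> R.
  rewrite -mulr_suml -natr_sum /residue_density natrM.
  by field; rewrite !pnatr_eq0 -!lt0n D0 M0.
under eq_cvg => Q.
  rewrite /lattice_density; under eq_lattice_count do rewrite /in_box /= -andbA.
  rewrite (lattice_count_periodic (cell D i Q) (cell D j Q) Q M0 fM) natr_sum mulr_suml.
  under eq_bigr do rewrite !natrM -mulrA expr2 invfM mulrACA.
  over.
apply: cvgn_sum => p _; apply: cvgM; first exact: cvg_cst.
by apply: cvgM; exact: cvg_residue_count_cell.
Qed.

End ResidueDensity.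

(** * Sieving out common divisors *)

Definition primitive (f : rel nat) : rel nat :=
  [rel a b | [&& (0 < a)%N, (0 < b)%N, coprime a b & f a b]].

Definition sieve (z : nat) (f : rel nat) : rel nat :=
  [rel a b | coprime (gcdn a b) z`! && f a b].

Lemma periodic_mod_sieve M z f : periodic_mod M f -> periodic_mod (M * z`!)%N (sieve z f).
Proof.
move=> fM a b; rewrite /sieve /= (periodic_mod_muln _ fM); congr andb.
have gcd_mod c : gcdn (c %% (M * z`!))%N z`! = gcdn c z`!.
  by rewrite -gcdn_modl modn_dvdm ?dvdn_mull // gcdn_modl.
have gcd3 x y : gcdn (gcdn x y) z`! = gcdn (gcdn x z`!) (gcdn y z`!).
  by rewrite gcdnACA gcdnn.
by rewrite /coprime !gcd3 !gcd_mod.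
Qed.

Lemma cell_gt0 D i Q a : cell D i Q a -> (0 < a)%N.
Proof. by case: a => // /andP[]; rewrite mul0n ltn0. Qed.

Lemma primitive_sieve z f a b : primitive f a b -> sieve z f a b.
Proof. by move=> /and4P[_ _ ab fab]; rewrite /sieve /= (eqP ab) coprime1n. Qed.

Lemma sieve_primitive z f a b : (0 < a)%N -> (0 < b)%N ->
  sieve z f a b -> primitive f a b || (z < gcdn a b)%N.
Proof.
move=> a0 b0 /andP[gcd_z fab]; rewrite /primitive /= a0 b0 fab andbT.
have [gcd_le|_] := leqP (gcdn a b) z; last by rewrite orbT.
have /gcdn_idPl gcdE : (gcdn a b %| z`!)%N by rewrite dvdn_fact // gcd_le gcdn_gt0 a0.
by rewrite /= orbF /coprime -gcdE.
Qed.

Lemma count_dvdn d Q : (0 < d)%N ->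
  (\sum_(a < Q.+1) ((0 < a) && (d %| a)))%N = (Q %/ d)%N.
Proof.
move=> d0; elim: Q => [|Q IHQ]; first by rewrite big_ord1 div0n.
by rewrite big_ord_recr IHQ /= divnS // addnC.
Qed.

Definition gcd_gt (z : nat) : rel nat :=
  [rel a b | [&& (0 < a)%N, (0 < b)%N & (z < gcdn a b)%N]].

Lemma lattice_count_gcd_gt z Q :
  (lattice_count Q (gcd_gt z) <= \sum_(z <= d < Q) (Q %/ d.+1) ^ 2)%N.
Proof.
under eq_bigr do rewrite -count_dvdn // -mulnn big_distrlr /=.
rewrite lattice_countE [leqRHS]exchange_big; apply: leq_sum => a _ /=.
rewrite [leqRHS]exchange_big; apply: leq_sum => b _ /=.
have [/and3P[a0 b0 z_gcd]|//] := boolP (gcd_gt z a b).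
have gcd_le := dvdn_leq a0 (dvdn_gcdl a b); have a_lt := ltn_ord a.
rewrite (bigD1_seq (gcdn a b).-1) ?mem_index_iota ?iota_uniq //=; last by lia.
by rewrite a0 b0 prednK ?dvdn_gcdl ?dvdn_gcdr //; lia.
Qed.

Lemma lattice_count_pos Q : lattice_count Q [rel a b | (0 < a) && (0 < b)]%N = (Q ^ 2)%N.
Proof.
rewrite lattice_countE -mulnn -[in RHS](divn1 Q) -(@count_dvdn 1 Q) // big_distrlr /=.
by apply: eq_bigr => a _; apply: eq_bigr => b _; rewrite !dvd1n !andbT mulnb.
Qed.

Section PrimitiveDensity.
Variable R : realType.

Lemma sum_inv_sqr_le z Q : (0 < z)%N ->
  \sum_(z <= d < Q) (d.+1%:R ^+ 2)^-1 <= z%:R^-1 :> R.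
Proof.
move=> z0; have [Qz|zQ] := leqP Q z; first by rewrite big_geq // invr_ge0.
apply: (@le_trans _ _ (\sum_(z <= d < Q) (- d.+1%:R^-1 - - d%:R^-1))); last first.
  by rewrite telescope_sumr 1?ltnW // opprK addrC gerBl invr_ge0.
rewrite big_nat [leRHS]big_nat; apply: ler_sum => d /andP[zd _].
have : 0 < d%:R :> R by rewrite ltr0n (leq_trans z0).
rewrite -natr1; move: (d%:R : R) => x x0.
have -> : - (x + 1)^-1 - - x^-1 = (x * (x + 1))^-1.
  by field; rewrite !gt_eqF // addr_gt0.
by rewrite lef_pV2 ?posrE ?expr2 ?mulr_gt0 ?ler_pM2r ?addr_gt0 ?lerDl.
Qed.

Lemma lattice_count_gcd_gt_le z Q :
  (lattice_count Q (gcd_gt z))%:R <=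
  \sum_(z <= d < Q) (d.+1%:R ^+ 2)^-1 * Q%:R ^+ 2 :> R.
Proof.
apply: le_trans (_ : (\sum_(z <= d < Q) (Q %/ d.+1) ^ 2)%N%:R <= _).
  by rewrite ler_nat lattice_count_gcd_gt.
rewrite natr_sum; apply: ler_sum => d _.
rewrite natrX mulrC ler_pdivlMr ?exprn_gt0 ?ltr0n // -exprMn -natrM.
by rewrite lerXn2r ?nnegrE // ler_nat leq_trunc_div.
Qed.

Lemma lattice_count_primitive_ge Q :
  4^-1 * Q%:R ^+ 2 <= (lattice_count Q (primitive [rel _ _ | true]))%:R :> R.
Proof.
have : (Q ^ 2 <= lattice_count Q (primitive [rel _ _ | true]) +
    lattice_count Q (gcd_gt 1))%N.
  rewrite -lattice_count_pos; apply: leq_lattice_countU => a b _ _ /andP[a0 b0].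
  rewrite /primitive /gcd_gt /= a0 b0 /coprime andbT /=.
  by have : (0 < gcdn a b)%N; [rewrite gcdn_gt0 a0|lia].
rewrite -(ler_nat R) natrD natrX.
(* Pairs with a common divisor [d >= 2] make up at most the fraction
   [1/4 + (1/3^2 + 1/4^2 + ...) <= 1/4 + 1/2] of all pairs. *)
suff : (lattice_count Q (gcd_gt 1))%:R <= 3 / 4 * Q%:R ^+ 2 :> R by lra.
apply: le_trans (lattice_count_gcd_gt_le _ _) _; rewrite -mulr_suml.
apply: ler_wpM2r; first exact: sqr_ge0.
have [Q1|Q1] := leqP Q 1; first by rewrite big_geq //; lra.
by rewrite big_ltn //; have := @sum_inv_sqr_le 2 Q isT; rewrite -natrX; lra.
Qed.

Lemma box_primitive_sieve_dist D i j z f Q : (0 < z)%N ->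
  `|lattice_density R Q [rel a b | in_box D i j Q a b && primitive f a b] -
    lattice_density R Q [rel a b | in_box D i j Q a b && sieve z f a b]| <= z%:R^-1.
Proof.
move=> z0; have [->|Q0] := posnP Q.
  by rewrite /lattice_density expr0n invr0 !mulr0 subr0 normr0 invr_ge0.
rewrite -mulrBl normrM [X in _ * X]ger0_norm ?invr_ge0 ?sqr_ge0 //.
rewrite ler_pdivrMr ?exprn_gt0 ?ltr0n // distrC ger0_norm; last first.
  rewrite subr_ge0 ler_nat; apply: leq_lattice_count => a b _ _ /andP[box_ab].
  by rewrite /= box_ab; exact: primitive_sieve.
apply: le_trans (_ : (lattice_count Q (gcd_gt z))%:R <= _); last first.
  apply: le_trans (lattice_count_gcd_gt_le _ _) _; rewrite -mulr_suml.
  by apply: ler_wpM2r; [exact: sqr_ge0|exact: sum_inv_sqr_le].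
rewrite lerBlDl -natrD ler_nat; apply: leq_lattice_countU => a b _ _ /andP[box_ab].
have /andP[/cell_gt0 a0 /cell_gt0 b0] := box_ab.
by rewrite /gcd_gt /= box_ab a0 b0; exact: sieve_primitive.
Qed.

Lemma cvg_sieve_box D i j M f :
  (0 < D)%N -> (i < D)%N -> (j < D)%N -> (0 < M)%N -> periodic_mod M f ->
  exists L : R,
    residue_density R (M * z.+1`!)%N (sieve z.+1 f) / D%:R ^+ 2 @[z --> \oo] --> L /\
    lattice_density R Q [rel a b | in_box D i j Q a b && primitive f a b]
      @[Q --> \oo] --> L.
Proof.
move=> D0 iD jD M0 fM; apply: (@cvg_uniform_approx R _ (fun z Q =>
  lattice_density R Q [rel a b | in_box D i j Q a b && sieve z.+1 f a b]) _ harmonic).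
- move=> z; apply: cvg_box_residue_density => //; first by rewrite muln_gt0 M0 fact_gt0.
  exact: periodic_mod_sieve.
- by move=> z Q; exact: box_primitive_sieve_dist.
- exact: cvg_harmonic.
Qed.

Definition primitive_density (M : nat) (f : rel nat) : R :=
  limn (fun z => residue_density R (M * z.+1`!)%N (sieve z.+1 f)).

Lemma cvg_box_primitive_density D i j M f :
  (0 < D)%N -> (i < D)%N -> (j < D)%N -> (0 < M)%N -> periodic_mod M f ->
  lattice_density R Q [rel a b | in_box D i j Q a b && primitive f a b] @[Q --> \oo] -->
  primitive_density M f / D%:R ^+ 2.
Proof.
move=> D0 iD jD M0 fM; have [L [densityL countL]] := cvg_sieve_box D0 iD jD M0 fM.
have [K [+ _]] := @cvg_sieve_box 1 0 0 M f isT isT isT M0 fM.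
under eq_cvg do rewrite expr1n divr1; move=> densityK.
have -> : primitive_density M f = K by exact: cvg_lim densityK.
suff -> : K / D%:R ^+ 2 = L by [].
by apply: cvg_unique (cvgM densityK (cvg_cst _)) densityL.
Qed.

End PrimitiveDensity.

(** * Primitive vectors in a parity class *)

Definition parity_class (e : bool * bool) : rel nat := [rel a b | (odd a, odd b) == e].

Lemma periodic_mod_parity_class e : periodic_mod 2 (parity_class e).
Proof. by move=> a b; rewrite /parity_class /= !odd_mod. Qed.

Lemma coprime_odd a b : coprime a b -> odd a || odd b.
Proof.
apply: contraLR; rewrite negb_or -!dvdn2 => /andP[a2 b2].
by apply/negP => /eqP ab1; have := dvdn_gcd 2 a b; rewrite ab1 a2 b2.
Qed.

Lemma lattice_count_parity Q (S : rel nat) : (forall a b, S a b -> coprime a b) ->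
  lattice_count Q S = (\sum_(e | e != (false, false))
    lattice_count Q [rel a b | S a b && parity_class e a b])%N.
Proof.
move=> S_coprime; rewrite exchange_big; apply: eq_bigr => -[a b] _ /=.
have [Sab|_] := boolP (S a b); last by rewrite big1.
have nonzero : (odd a, odd b) != (false, false).
  by have := coprime_odd (S_coprime a b Sab); case: (odd a) (odd b) => [] [].
rewrite (bigD1 (odd a, odd b)) //= /parity_class /= eqxx big1 // => e /andP[_ ne].
by rewrite eq_sym (negbTE ne).
Qed.

Section ParityDensity.
Variable R : realType.

Lemma residue_density_swap N f :
  residue_density R N [rel a b | f b a] = residue_density R N f.
Proof.
congr (_%:R / _); rewrite -(pair_bigA _ (fun a b : 'I_N => f b a : nat)) exchange_big.
by rewrite pair_bigA.
Qed.

Lemma residue_density_shear N f : (0 < N)%N -> periodic_mod N f ->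
  residue_density R N [rel a b | f a (a + b)%N] = residue_density R N f.
Proof.
case: N => // N _ fN; congr (_%:R / _).
pose shear (p : 'I_N.+1 * 'I_N.+1) := (p.1, p.1 + p.2).
have shear_inj : injective shear.
  by move=> [a b] [c d] /eqP; rewrite xpair_eqE /= => /andP[/eqP-> /eqP/addrI->].
rewrite [RHS](reindex_inj shear_inj); apply: eq_bigr => -[a b] _ /=.
by rewrite -[in LHS]fN modn_small.
Qed.

Lemma primitive_density_swap M f :
  primitive_density R M [rel a b | f b a] = primitive_density R M f.
Proof.
congr (limn _); apply/funext => z; rewrite -[RHS]residue_density_swap.
by congr (_%:R / _); apply: eq_bigr => -[a b] _; rewrite /sieve /= gcdnC.
Qed.

Lemma primitive_density_shear M f : (0 < M)%N -> periodic_mod M f ->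
  primitive_density R M [rel a b | f a (a + b)%N] = primitive_density R M f.
Proof.
move=> M0 fM; congr (limn _); apply/funext => z.
rewrite -[RHS]residue_density_shear ?muln_gt0 ?M0 ?fact_gt0 //; last first.
  exact: periodic_mod_sieve.
by congr (_%:R / _); apply: eq_bigr => -[a b] _; rewrite /sieve /= gcdnDl.
Qed.

Definition parity_density : R := primitive_density R 2 (parity_class (true, false)).

Lemma primitive_density_parity_class e : e != (false, false) ->
  primitive_density R 2 (parity_class e) = parity_density.
Proof.
case: e => [[] []] // _; last first.
  rewrite -primitive_density_swap; congr primitive_density.
  by apply/funext => a; apply/funext => b; rewrite /parity_class /= !xpair_eqE andbC.
rewrite -primitive_density_shear //; last exact: periodic_mod_parity_class.
congr primitive_density; apply/funext => a; apply/funext => b.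
by rewrite /parity_class /= oddD !xpair_eqE; case: (odd a) (odd b) => [] [].
Qed.

Lemma cvg_box_parity_density D i j e :
  (0 < D)%N -> (i < D)%N -> (j < D)%N -> e != (false, false) ->
  lattice_density R Q [rel a b | in_box D i j Q a b && primitive (parity_class e) a b]
    @[Q --> \oo] --> parity_density / D%:R ^+ 2.
Proof.
move=> D0 iD jD e0; rewrite -(primitive_density_parity_class e0).
by apply: cvg_box_primitive_density => //; exact: periodic_mod_parity_class.
Qed.

Lemma cvg_parity_density e : e != (false, false) ->
  lattice_density R Q (primitive (parity_class e)) @[Q --> \oo] --> parity_density.
Proof.
move=> /(@cvg_box_parity_density 1 0 0 _ isT isT isT); rewrite expr1n divr1.
under eq_cvg => Q.
  rewrite /lattice_density (eq_lattice_count (T := primitive (parity_class e))); last first.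
    move=> a b aQ bQ; rewrite /in_box /cell /primitive /= !muln1 !mul0n !mul1n aQ bQ !andbT.
    by case: (0 < a)%N (0 < b)%N => [] [].
  over.
exact.
Qed.

Lemma parity_density_gt0 : 0 < parity_density.
Proof.
suff : 4^-1 <= \sum_(e : bool * bool | e != (false, false)) parity_density.
  rewrite sumr_const => density_ge; have : 0 < (4^-1 : R) by [].
  by move=> /lt_le_trans/(_ density_ge); rewrite pmulrn_lgt0 // cardC1 card_prod card_bool.
apply: (ler_cvg_to (cvg_cst (4^-1 : R))
  (cvgn_sum (fun e => @cvg_parity_density e) (s := _))).
near=> Q.
have Q0 : 0 < Q%:R ^+ 2 :> R.
  by rewrite exprn_gt0 // ltr0n; near: Q; exact: nbhs_infty_gt.
rewrite -mulr_suml -natr_sum ler_pdivlMr //.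
apply: le_trans (lattice_count_primitive_ge R Q) _; rewrite lattice_count_parity => [|a b].
  rewrite ler_nat leq_sum // => e _; apply: leq_lattice_count => a b _ _.
  by rewrite /primitive /= => /andP[/and4P[-> -> -> _] ->].
by case/and4P.
Unshelve. all: by end_near. Qed.

End ParityDensity.

(** * Equidistribution of finitely additive set functions *)

Lemma openX (T U : topologicalType) (A : set T) (B : set U) :
  open A -> open B -> open (A `*` B).
Proof.
by move=> oA oB; apply: openI; apply: open_comp => // p _; [exact: cvg_fst|exact: cvg_snd].
Qed.

Section UnitSquare.
Variable R : realType.
Implicit Types A B U : set (R * R).
Local Notation mu := (@lebesgue_measure R \x @lebesgue_measure R)%E.

Lemma area_itvX (sa ta sc tc : bool) (a b c d : R) : a <= b -> c <= d ->
  mu ([set` Interval (BSide sa a) (BSide ta b)] `*`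
      [set` Interval (BSide sc c) (BSide tc d)]) = ((b - a) * (d - c))%:E.
Proof.
have length s t (x y : R) : x <= y ->
    @lebesgue_measure R [set` Interval (BSide s x) (BSide t y)] = (y - x)%:E.
  rewrite lebesgue_measure_itv /= lte_fin le_eqVlt => /orP[/eqP->|->].
    by rewrite ltxx subrr.
  by rewrite -EFinB.
move=> ab cd; rewrite EFinM -(length sa ta) // -(length sc tc) //.
exact: product_measure1E.
Qed.

Definition unit_square : set (R * R) := `]0, 1] `*` `]0, 1].

Lemma measurable_unit_square : measurable unit_square.
Proof. exact: measurableX. Qed.

Lemma area_unit_square : mu unit_square = 1%:E.
Proof. by rewrite area_itvX // subr0 mulr1. Qed.

Lemma fin_num_area A : measurable A -> A `<=` unit_square -> mu A \is a fin_num.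
Proof.
move=> mA A_sub; rewrite ge0_fin_numE ?measure_ge0 //.
apply: (@le_lt_trans _ _ (mu unit_square)); last by rewrite area_unit_square ltry.
by apply: le_measure; rewrite ?inE //; exact: measurable_unit_square.
Qed.

Definition dyadic_ocitv (n i : nat) : set R := `]i%:R / (2 ^ n)%:R, i.+1%:R / (2 ^ n)%:R].

Lemma dyadic_ocitvS n i :
  dyadic_ocitv n i = dyadic_ocitv n.+1 i.*2 `|` dyadic_ocitv n.+1 i.*2.+1.
Proof.
have D0 : 0 < (2 ^ n)%:R :> R by rewrite ltr0n expn_gt0.
have halve k : k.*2%:R / (2 ^ n.+1)%:R = k%:R / (2 ^ n)%:R :> R.
  by rewrite expnS -muln2 !natrM; field; rewrite gt_eqF.
have grid_le k : k%:R / (2 ^ n.+1)%:R <= k.+1%:R / (2 ^ n.+1)%:R :> R.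
  by rewrite ler_pM2r ?invr_gt0 ?ltr0n ?expn_gt0 // ler_nat.
rewrite /dyadic_ocitv -itv_bndbnd_setU ?halve -?doubleS ?halve //.
  by rewrite -halve bnd_simp grid_le.
by rewrite -halve bnd_simp grid_le.
Qed.

Lemma dyadic_ocitv_cover n (x : R) : 0 < x <= 1 ->
  exists2 i, (i < 2 ^ n)%N & dyadic_ocitv n i x.
Proof.
move=> x01; elim: n => [|n [i i_lt]].
  by exists 0%N => //; rewrite /dyadic_ocitv /= in_itv /= mul0r divr1.
rewrite dyadic_ocitvS expnS mul2n => -[] xi; [exists i.*2|exists i.*2.+1] => //.
  by rewrite ltn_double.
by rewrite ltn_Sdouble.
Qed.

Lemma dyadic_ocitv_inj n i j (x : R) : dyadic_ocitv n i x -> dyadic_ocitv n j x -> i = j.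
Proof.
have D0 : 0 < (2 ^ n)%:R :> R by rewrite ltr0n expn_gt0.
rewrite /dyadic_ocitv /= !in_itv /= !ltr_pdivrMr // !ler_pdivlMr //.
move=> /andP[ix xi] /andP[jx xj].
by have := (lt_le_trans ix xj, lt_le_trans jx xi); rewrite !ltr_nat => -[]; lia.
Qed.

Lemma dyadic_ocitv_ball n i (x y e : R) : (2 ^ n)%:R^-1 < e ->
  dyadic_ocitv n i x -> dyadic_ocitv n i y -> ball x e y.
Proof.
rewrite /dyadic_ocitv /ball /= !in_itv /= -natr1 mulrDl mul1r ltr_norml.
by move=> e_gt /andP[? ?] /andP[? ?]; apply/andP; split; lra.
Qed.

Definition dyadic_square (n i j : nat) : set (R * R) :=
  dyadic_ocitv n i `*` dyadic_ocitv n j.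

Lemma measurable_dyadic_square n i j : measurable (dyadic_square n i j).
Proof. by apply: measurableX; exact: measurable_itv. Qed.

Lemma area_dyadic_square n i j : mu (dyadic_square n i j) = ((2 ^ n)%:R ^- 2)%:E.
Proof.
have D0 : 0 < (2 ^ n)%:R :> R by rewrite ltr0n expn_gt0.
rewrite area_itvX ?ler_pM2r ?invr_gt0 ?ler_nat // -!natr1.
by congr EFin; field; rewrite gt_eqF.
Qed.

Definition dyadic_inner U (n : nat) : set (R * R) :=
  \big[setU/set0]_(p : 'I_(2 ^ n) * 'I_(2 ^ n) | `[< dyadic_square n p.1 p.2 `<=` U >])
     dyadic_square n p.1 p.2.

Lemma dyadic_innerP U n x : dyadic_inner U n x <->
  exists i j, [/\ (i < 2 ^ n)%N, (j < 2 ^ n)%N, dyadic_square n i j `<=` U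
                & dyadic_square n i j x].
Proof.
rewrite /dyadic_inner -bigcup_pred; split=> [[[i j] /= /asboolP subU ij_x]|].
  by exists i, j; split => //; exact: ltn_ord.
by move=> [i [j [iD jD subU ij_x]]]; exists (Ordinal iD, Ordinal jD) => //=; apply/asboolP.
Qed.

Lemma dyadic_inner_sub U n : dyadic_inner U n `<=` U.
Proof. by move=> x /dyadic_innerP[i [j [_ _ subU /subU]]]. Qed.

Lemma measurable_dyadic_inner U n : measurable (dyadic_inner U n).
Proof. by apply: bigsetU_measurable => p _; exact: measurable_dyadic_square. Qed.

Lemma dyadic_inner_mono U : {homo dyadic_inner U : n m / (n <= m)%N >-> (n <= m)%O}.
Proof.
apply: homo_leq => [x|y x z|n]; [exact: lexx|exact: le_trans|].
have halves i x : (i < 2 ^ n)%N -> dyadic_ocitv n i x -> exists i',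
    [/\ (i' < 2 ^ n.+1)%N, dyadic_ocitv n.+1 i' x
      & dyadic_ocitv n.+1 i' `<=` dyadic_ocitv n i].
  rewrite dyadic_ocitvS expnS mul2n => i_lt [xi|xi].
    by exists i.*2; rewrite ltn_double; split=> //; exact: subsetUl.
  by exists i.*2.+1; rewrite ltn_Sdouble; split=> //; exact: subsetUr.
apply/subsetPset => -[x y] /dyadic_innerP[i [j [iD jD subU [/= xi yj]]]].
apply/dyadic_innerP; have [i' [iD' xi' i'_sub]] := halves _ _ iD xi.
have [j' [jD' yj' j'_sub]] := halves _ _ jD yj; exists i', j'; split => //.
by apply: subset_trans subU; exact: setSX.
Qed.

Lemma bigcup_dyadic_inner U : open U -> U `<=` unit_square ->
  \bigcup_n dyadic_inner U n = U.
Proof.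
move=> oU U_sub; apply/seteqP; split=> [x [n _ /dyadic_inner_sub//]|[x y] Uxy].
have /nbhs_ballP[e /= e0 ballU] : nbhs (x, y) U by exact: open_nbhs_nbhs.
near \oo => n; exists n => //.
have e_gt : (2 ^ n)%:R^-1 < e.
  rewrite -[e]invrK ltf_pV2 ?posrE ?invr_gt0 ?ltr0n ?expn_gt0 //.
  apply: lt_trans (_ : n%:R < _); last by rewrite ltr_nat ltn_expl.
  by near: n; exact: nbhs_infty_gtr.
have [/=] := U_sub _ Uxy; rewrite !in_itv /= => x01 y01.
have [i iD xi] := dyadic_ocitv_cover n x01; have [j jD yj] := dyadic_ocitv_cover n y01.
apply/dyadic_innerP; exists i, j; split => // -[u v] [/= ui vj]; apply: ballU.
by split; [exact: dyadic_ocitv_ball e_gt xi ui|exact: dyadic_ocitv_ball e_gt yj vj].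
Unshelve. all: by end_near. Qed.

Lemma measurable_open_unit_square U : open U -> U `<=` unit_square -> measurable U.
Proof.
move=> oU U_sub; rewrite -(bigcup_dyadic_inner oU U_sub).
by apply: bigcup_measurable => n _; exact: measurable_dyadic_inner.
Qed.

Lemma cvg_area_dyadic_inner U : open U -> U `<=` unit_square ->
  fine (mu (dyadic_inner U n)) @[n --> \oo] --> fine (mu U).
Proof.
move=> oU U_sub; have mU := measurable_open_unit_square oU U_sub.
apply: fine_cvg; rewrite fineK; last exact: fin_num_area.
rewrite -[in X in _ --> X](bigcup_dyadic_inner oU U_sub).
apply: nondecreasing_cvg_mu; [exact: measurable_dyadic_inner| |exact: dyadic_inner_mono].
by rewrite bigcup_dyadic_inner.
Qed.

Definition open_exterior A : set (R * R) := `]0, 1[ `*` `]0, 1[ `\` closure A.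

Lemma open_open_exterior A : open (open_exterior A).
Proof.
rewrite /open_exterior setDE; apply: openI; first by apply: openX; exact: itv_open.
by apply: closed_openC; exact: closed_closure.
Qed.

Lemma open_exterior_sub A : open_exterior A `<=` unit_square.
Proof.
by apply: subset_trans (@subDsetl _ _ _) _; apply: setSX; exact: subset_itv_oo_oc.
Qed.

Lemma setI_open_exterior A : A `&` open_exterior A = set0.
Proof. by rewrite -subset0 => p [/subset_closure Ap [_ /(_ Ap)]]. Qed.

Lemma area_jordan A : measurable A -> A `<=` unit_square ->
  mu.-negligible (closure A `\` A°) ->
  fine (mu A°) = fine (mu A) /\ fine (mu (open_exterior A)) = 1 - fine (mu A).
Proof.
move=> mA A_sub [N [mN muN0 frontier_sub]].
have U_sub : A° `<=` unit_square := subset_trans (@interior_subset _ A) A_sub.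
have mU := measurable_open_unit_square (@open_interior _ A) U_sub.
have V_sub := @open_exterior_sub A.
have mV := measurable_open_unit_square (@open_open_exterior A) V_sub.
have mUV := measurableU _ _ mU mV.
have area_le : fine (mu A°) <= fine (mu A).
  rewrite fine_le ?fin_num_area //; apply: le_measure; rewrite ?inE //.
  exact: interior_subset.
have area_add_le : fine (mu A) + fine (mu (open_exterior A)) <= 1.
  rewrite -fineD ?fin_num_area // -measureU ?setI_open_exterior //.
  have AV_sub : A `|` open_exterior A `<=` unit_square by rewrite subUset.
  rewrite -[leRHS](_ : fine (mu unit_square) = _) ?area_unit_square //.
  have mAV := measurableU _ _ mA mV.
  have mS := measurable_unit_square; rewrite fine_le ?fin_num_area //.
  by rewrite -area_unit_square; apply: le_measure; rewrite ?inE.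
have area_add_ge : 1 <= fine (mu A°) + fine (mu (open_exterior A)).
  rewrite -lee_fin EFinD !fineK ?fin_num_area //.
  have <- : mu (`]0, 1[ `*` `]0, 1[) = 1%:E by rewrite area_itvX // subr0 mulr1.
  apply: (@le_trans _ _ (mu (A° `|` open_exterior A `|` N))); last first.
    by rewrite measureU0 //; exact: measureU2.
  apply: le_measure; rewrite ?inE; [exact: measurableX|exact: measurableU|].
  move=> p p01; have [Ap|nAp] := pselect (closure A p); last by left; right.
  have [Up|nUp] := pselect (A° p); first by left; left.
  by right; exact: frontier_sub.
by split; lra.
Qed.

End UnitSquare.

Arguments unit_square R : clear implicits.

Section Equidistribution.
Variable R : realType.
Implicit Types A B U : set (R * R).
Local Notation mu := (@lebesgue_measure R \x @lebesgue_measure R)%E.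

Variables (m : nat -> set (R * R) -> R) (kappa : R).
Hypothesis m_ge0 : forall Q A, 0 <= m Q A.
Hypothesis m_additive : forall Q A B, A `&` B = set0 -> m Q (A `|` B) = m Q A + m Q B.

Definition equidistributed A : Prop := m Q A @[Q --> \oo] --> kappa * fine (mu A).

Hypothesis equidistributed_dyadic_square : forall n i j,
  (i < 2 ^ n)%N -> (j < 2 ^ n)%N -> equidistributed (@dyadic_square R n i j).

Lemma finitely_additive0 Q : m Q set0 = 0.
Proof. by apply: (addrI (m Q set0)); rewrite -m_additive ?setI0 // setU0 addr0. Qed.

Lemma finitely_additive_le Q A B : A `<=` B -> m Q A <= m Q B.
Proof. by move=> AB; rewrite -(setDUK AB) m_additive ?setDIK // lerDl. Qed.

Lemma equidistributedU A B : measurable A -> measurable B ->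
  A `<=` unit_square R -> B `<=` unit_square R -> A `&` B = set0 ->
  equidistributed A -> equidistributed B -> equidistributed (A `|` B).
Proof.
move=> mA mB A_sub B_sub AB0 eqA eqB; rewrite /equidistributed measureU //.
rewrite fineD ?fin_num_area // mulrDr.
under eq_cvg do rewrite m_additive //.
exact: cvgD.
Qed.

Lemma equidistributed_bigsetU (I : choiceType) (s : seq I) (P : pred I)
    (F : I -> set (R * R)) :
  uniq s -> trivIset [set i | P i] F -> (forall i, measurable (F i)) ->
  (forall i, P i -> F i `<=` unit_square R) -> (forall i, P i -> equidistributed (F i)) ->
  equidistributed (\big[setU/set0]_(i <- s | P i) F i).
Proof.
move=> + trivF mF F_sub eqF; elim: s => [_|i s IHs /= /andP[i_s s_uniq]].
  rewrite big_nil /equidistributed measure0 mulr0.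
  by under eq_cvg do rewrite finitely_additive0; exact: cvg_cst.
rewrite big_cons; case: ifP => Pi; last exact: IHs.
apply: equidistributedU => //.
- exact: bigsetU_measurable.
- exact: F_sub.
- by rewrite -bigcup_seq_cond; apply: bigcup_sub => j /= /andP[_]; exact: F_sub.
- rewrite -subset0 -bigcup_seq_cond => p [Fip [j /= /andP[j_s Pj] Fjp]].
  by move: i_s; rewrite (trivF i j) ?j_s //; exists p.
- exact: eqF.
- exact: IHs.
Qed.

Lemma equidistributed_dyadic_inner U n : U `<=` unit_square R ->
  equidistributed (dyadic_inner U n).
Proof.
move=> U_sub; apply: equidistributed_bigsetU.
- exact: index_enum_uniq.
- move=> [i j] [i' j'] _ _ [[x y] [[/= xi yj] [/= xi' yj']]].
  congr pair; apply/val_inj; first exact: dyadic_ocitv_inj xi xi'.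
  exact: dyadic_ocitv_inj yj yj'.
- by move=> p; exact: measurable_dyadic_square.
- by move=> p /asboolP /subset_trans; apply.
- by move=> p _; exact: equidistributed_dyadic_square.
Qed.

Lemma near_lt_open U c : open U -> U `<=` unit_square R -> c < kappa * fine (mu U) ->
  \forall Q \near \oo, c < m Q U.
Proof.
move=> oU U_sub c_lt.
have cvg_inner : kappa * fine (mu (dyadic_inner U n)) @[n --> \oo] --> kappa * fine (mu U).
  by apply: cvgM; [exact: cvg_cst|exact: cvg_area_dyadic_inner].
have [n c_lt_n] : exists n, c < kappa * fine (mu (dyadic_inner U n)).
  by near \oo => n; exists n; near: n; exact: cvgr_gt cvg_inner _ c_lt.
near=> Q; apply: lt_le_trans (finitely_additive_le Q (@dyadic_inner_sub R U n)).
by near: Q; exact: cvgr_gt (equidistributed_dyadic_inner U_sub) _ c_lt_n.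
Unshelve. all: by end_near. Qed.

Lemma equidistributed_unit_square : equidistributed (unit_square R).
Proof.
suff <- : @dyadic_square R 0 0 0 = unit_square R by exact: equidistributed_dyadic_square.
by rewrite /dyadic_square /dyadic_ocitv mul0r divr1.
Qed.

Theorem equidistributed_jordan A : measurable A -> A `<=` unit_square R ->
  mu.-negligible (closure A `\` A°) -> equidistributed A.
Proof.
move=> mA A_sub frontier0; have [areaU areaV] := area_jordan mA A_sub frontier0.
set V := open_exterior A in areaV.
have [oU U_sub] := (@open_interior _ A, subset_trans (@interior_subset _ A) A_sub).
have oV : open V by exact: open_open_exterior.
have V_sub : V `<=` unit_square R by exact: open_exterior_sub.
apply/cvgrPdist_le => e e0.
have e2 : 0 < e / 2 by rewrite divr_gt0.
have areaU_gt : kappa * fine (mu A) - e < kappa * fine (mu A°) by rewrite areaU; lra.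
have areaV_gt : kappa * (1 - fine (mu A)) - e / 2 < kappa * fine (mu V).
  by rewrite areaV; lra.
have area_lt : kappa * fine (mu (unit_square R)) < kappa + e / 2.
  by rewrite area_unit_square /=; lra.
near=> Q.
have mU_gt : kappa * fine (mu A) - e < m Q A°.
  by near: Q; exact: near_lt_open areaU_gt.
have mV_gt : kappa * (1 - fine (mu A)) - e / 2 < m Q V.
  by near: Q; exact: near_lt_open areaV_gt.
have m_lt : m Q (unit_square R) < kappa + e / 2.
  by near: Q; exact: cvgr_lt equidistributed_unit_square _ area_lt.
have mU_le := finitely_additive_le Q (@interior_subset _ A).
have : m Q (A `|` V) <= m Q (unit_square R).
  by apply: finitely_additive_le; rewrite subUset.
rewrite m_additive ?setI_open_exterior // ler_distl => mV_le; apply/andP; split; lra.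
Unshelve. all: by end_near. Qed.

End Equidistribution.

(** * Countable unions and the floor function *)

Section CountableUnions.
Context d (T : measurableType d) (R : realType) (mu : {measure set T -> \bar R}).

Lemma negligible_bigcup_countType (I : countType) (F : I -> set T) :
  (forall i, mu.-negligible (F i)) -> mu.-negligible (\bigcup_i F i).
Proof.
move=> F0; pose G n := if unpickle n is Some i then F i else set0.
suff -> : \bigcup_i F i = \bigcup_n G n.
  apply: negligible_bigcup => n; rewrite /G; case: unpickle => // *.
  exact: negligible_set0.
apply/seteqP; split=> x [i _]; first by exists (pickle i) => //; rewrite /G pickleK.
by rewrite /G; case: unpickle => // j; exists j.
Qed.

Lemma measure_bigcup_countType (I : countType) (D : set I) (F : I -> set T) :
  (forall i, measurable (F i)) -> trivIset D F ->
  mu (\bigcup_(i in D) F i) = (\esum_(i in D) mu (F i))%E.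
Proof.
move=> mF trivF; pose G n := if @pickle_inv I n is Some i then F i else set0.
have GE i : G (pickle i) = F i by rewrite /G pickleK_inv.
rewrite (_ : \bigcup_(i in D) F i = \bigcup_(n in pickle @` D) G n); last first.
  by rewrite bigcup_image; apply: eq_bigcupr => i _; rewrite GE.
rewrite measure_bigcup.
- rewrite nneseries_esum => [|n _]; last exact: measure_ge0.
  rewrite set_mem_set esum_image => [|i j _ _]; last exact: (pcan_inj pickleK).
  by apply: eq_esum => i _; rewrite GE.
- by move=> _ [i _ <-]; rewrite GE.
- by move=> _ _ [i Di <-] [j Dj <-]; rewrite !GE => /(trivF _ _ Di Dj) ->.
Qed.

End CountableUnions.

Section RealFunctions.
Variable R : realType.

Lemma measurable_fun_floor : measurable_fun setT (fun x : R => (Num.floor x)%:~R : R).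
Proof.
by apply: nondecreasing_measurable => // x y xy; rewrite ler_int le_floor.
Qed.

Lemma measurable_fun_inv : measurable_fun setT (@GRing.inv R).
Proof.
rewrite -(setUv [set 0]); apply/measurable_funU => //; first exact: measurableC.
split; first exact: measurable_fun_set1.
apply: open_continuous_measurable_fun.
  by apply: closed_openC; exact: closed_eq.
by move=> x; rewrite inE /= => /eqP x0; apply: cvgV => //; exact: cvg_id.
Qed.

Lemma near_floor (x : R) : x \isn't a Num.int ->
  \forall y \near x, Num.floor y = Num.floor x.
Proof.
rewrite intrEfloor => xN; have /andP[x_ge x_lt] := floor_itv x.
have : x \in `](Num.floor x)%:~R, (Num.floor x + 1)%:~R[.
  by rewrite in_itv /= lt_neqAle xN x_ge.
move=> /near_in_itvoo; apply: filterS => y; rewrite in_itv /= => /andP[y_gt y_lt].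
by apply: floor_def; rewrite ltW.
Qed.

End RealFunctions.

(** * Level sets of the indices *)

Section FareyTriangle.
Variable R : realType.
Implicit Types p : R * R.
Local Notation mu := (@lebesgue_measure R \x @lebesgue_measure R)%E.

Lemma fareyTP p : reflect (fareyT p) [&& p.1 <= 1, p.2 <= 1 & 1 < p.1 + p.2].
Proof.
apply: (iffP and3P) => [[p1 p2 p12]|[/andP[_ p1] /andP[_ p2] p12] //].
by split=> //; apply/andP; split=> //; lra.
Qed.

Lemma fareyT_sub : @fareyT R `<=` unit_square R.
Proof. by move=> p [p1 p2 _]; split; rewrite /= in_itv. Qed.

Lemma fareyT_next (u v : R) : fareyT (u, v) ->
  fareyT (v, (Num.floor ((1 + u) / v))%:~R * v - u).
Proof.
move=> [/= /andP[u0 u1] /andP[v0 v1] uv].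
have := floor_itv ((1 + u) / v); rewrite ler_pdivlMr // ltr_pdivrMr // intrD.
by move=> /andP[floor_le floor_gt]; apply/fareyTP/and3P; split=> /=; lra.
Qed.

Lemma LseqSS p n : Lseq p n.+2 = (kidx p n)%:~R * Lseq p n.+1 - Lseq p n.
Proof. by []. Qed.

Lemma Lseq_fareyT p n : fareyT p -> fareyT (Lseq p n, Lseq p n.+1).
Proof.
move=> Tp; elim: n => [|n /fareyT_next IHn]; first by case: p Tp.
by rewrite LseqSS.
Qed.

Lemma kidx_ge0 p n : fareyT p -> 0 <= kidx p n.
Proof.
move=> /(Lseq_fareyT n)[/= /andP[u0 _] /andP[v0 _] _].
by rewrite floor_ge0 divr_ge0 ?addr_ge0 // ltW.
Qed.

Lemma Lseq_int_comb p n :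
  exists a b : int, Lseq p n = a%:~R * p.1 + b%:~R * p.2.
Proof.
suff [] : (exists a b : int, Lseq p n = a%:~R * p.1 + b%:~R * p.2) /\
          (exists a b : int, Lseq p n.+1 = a%:~R * p.1 + b%:~R * p.2) by [].
elim: n => [|n [[a [b ab]] [c [d cd]]]].
  by split; [exists 1, 0|exists 0, 1]; rewrite /= mul1r mul0r ?addr0 ?add0r.
split; first by exists c, d.
exists (kidx p n * c - a), (kidx p n * d - b).
by rewrite LseqSS ab cd !intrD !intrN !intrM; ring.
Qed.

Lemma measurable_kidx_comp n :
  measurable_fun setT (@Lseq R ^~ n) -> measurable_fun setT (@Lseq R ^~ n.+1) ->
  measurable_fun setT (fun p => (kidx p n)%:~R : R).
Proof.
move=> mLn mLn1.
apply: (measurableT_comp (@measurable_fun_floor R)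
  (g := fun p => (1 + Lseq p n) / Lseq p n.+1)).
apply: measurable_funM; first exact: measurable_funD.
exact: (measurableT_comp (@measurable_fun_inv R) (g := @Lseq R ^~ n.+1)).
Qed.

Lemma measurable_Lseq n : measurable_fun setT (@Lseq R ^~ n).
Proof.
suff [] : measurable_fun setT (@Lseq R ^~ n) /\ measurable_fun setT (@Lseq R ^~ n.+1) by [].
elim: n => [|n [mLn mLn1]]; first by split; [exact: measurable_fst|exact: measurable_snd].
split=> //; apply: measurable_funB => //.
apply: measurable_funM => //; exact: measurable_kidx_comp.
Qed.

Lemma measurable_kidx n : measurable_fun setT (fun p => (kidx p n)%:~R : R).
Proof. by apply: measurable_kidx_comp; exact: measurable_Lseq. Qed.

Definition lattice_generic p : Prop := forall a b : int, a%:~R * p.1 + b%:~R * p.2 != 1.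

Lemma measurable_line (a b c : R) : measurable [set p : R * R | a * p.1 + b * p.2 = c].
Proof.
have mlin : measurable_fun setT (fun p : R * R => a * p.1 + b * p.2).
  by apply: measurable_funD; apply: measurable_funM => //; exact: measurable_cst.
by have := mlin measurableT [set c] (measurable_set1 c); rewrite setTI.
Qed.

Lemma area_line (a b c : R) : (a, b) != (0, 0) ->
  mu [set p | a * p.1 + b * p.2 = c] = 0%E.
Proof.
have [->|b0] := eqVneq b 0; rewrite xpair_eqE.
  rewrite eqxx andbT => a0.
  have -> : [set p : R * R | a * p.1 + 0 * p.2 = c] = [set c / a] `*` setT.
    apply/seteqP; split=> -[x y]; rewrite /= mul0r addr0.
      by move=> <-; split=> //; rewrite mulrAC divff // mul1r.
    by move=> [-> _]; rewrite mulrC divfK.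
  transitivity (@lebesgue_measure R [set (c / a)%R] * @lebesgue_measure R setT)%E.
    by apply: product_measure1E => //; exact: measurable_set1.
  by rewrite lebesgue_measure_set1 mul0e.
move=> _; rewrite [LHS]/product_measure1 /= integral0_eq // => x _ /=.
apply/eqP; rewrite eq_le measure_ge0 andbT -(lebesgue_measure_set1 ((c - a * x) / b)).
apply: le_measure; rewrite ?inE; [|exact: measurable_set1|].
  by apply: measurable_xsection; exact: measurable_line.
move=> y; rewrite /xsection /= inE /= => <-.
by rewrite [a * x + _]addrC addrK mulrAC divff // mul1r.
Qed.

Lemma negligible_not_lattice_generic : mu.-negligible [set p | ~ lattice_generic p].
Proof.
pose line (ab : int * int) := [set p : R * R | ab.1%:~R * p.1 + ab.2%:~R * p.2 = 1].
suff : mu.-negligible (\bigcup_ab line ab).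
  apply: negligibleS => p; apply: contra_notP => nline a b.
  by apply/eqP => line_p; apply: nline; exists (a, b).
apply: negligible_bigcup_countType => -[a b]; apply/negligibleP.
  exact: measurable_line.
have [[-> ->]|ab0] := eqVneq (a, b) (0, 0).
  rewrite (_ : line (0, 0) = set0) ?measure0 // -subset0 => p.
  by rewrite /line /= !mul0r addr0 => /esym/eqP; rewrite oner_eq0.
by apply: area_line; move: ab0; rewrite !xpair_eqE !intr_eq0.
Qed.

Lemma continuous_linear_form (a b : R) : continuous (fun p : R * R => a * p.1 + b * p.2).
Proof.
by move=> p; apply: cvgD; apply: cvgM; try exact: cvg_cst; [exact: cvg_fst|exact: cvg_snd].
Qed.

Lemma near_int_form_gt1 p (a b : int) : lattice_generic p ->
  \forall q \near p, (1 < a%:~R * q.1 + b%:~R * q.2) = (1 < a%:~R * p.1 + b%:~R * p.2 :> R).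
Proof.
have cont := @continuous_linear_form a%:~R b%:~R p.
move=> /(_ a b); rewrite neq_lt => /orP[p_lt|p_gt]; near=> q.
  by rewrite [RHS]ltNge ltW // [LHS]ltNge ltW //; near: q; exact: cvgr_lt cont _ p_lt.
by rewrite p_gt; near: q; exact: cvgr_gt cont _ p_gt.
Unshelve. all: by end_near. Qed.

Lemma near_fareyT p : lattice_generic p -> \forall q \near p, fareyT q <-> fareyT p.
Proof.
move=> gp; apply: filterS3 (near_int_form_gt1 1 0 gp) (near_int_form_gt1 0 1 gp)
  (near_int_form_gt1 1 1 gp) => q.
rewrite !mul1r !mul0r !addr0 !add0r => x_gt1 y_gt1 sum_gt1.
have bounds : [&& q.1 <= 1, q.2 <= 1 & 1 < q.1 + q.2] =
    [&& p.1 <= 1, p.2 <= 1 & 1 < p.1 + p.2] by rewrite !leNgt x_gt1 y_gt1 sum_gt1.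
by split=> /fareyTP; [rewrite bounds|rewrite -bounds] => /fareyTP.
Qed.

Lemma near_kidx p n : fareyT p -> lattice_generic p ->
  {for p, continuous (@Lseq R ^~ n)} -> {for p, continuous (@Lseq R ^~ n.+1)} ->
  \forall q \near p, kidx q n = kidx p n.
Proof.
move=> Tp gp cont_n cont_n1.
have v0 : 0 < Lseq p n.+1 by case: (Lseq_fareyT n Tp) => /= _ /andP[].
have cvg_ratio : (1 + Lseq q n) / Lseq q n.+1 @[q --> p] --> (1 + Lseq p n) / Lseq p n.+1.
  apply: cvgM; first by apply: cvgD => //; exact: cvg_cst.
  by apply: cvgV => //; rewrite gt_eqF.
apply: (cvg_ratio [set y | Num.floor y = kidx p n]); apply: near_floor.
apply/negP => /intrP[k /(canRL (divfK (lt0r_neq0 v0)))].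
have [[a [b ->]] [c [d ->]]] := (Lseq_int_comb p n, Lseq_int_comb p n.+1).
move=> comb; have /eqP := gp (k * c - a) (k * d - b); apply.
rewrite !intrD !intrN !intrM; lra.
Qed.

Lemma continuous_Lseq p n : fareyT p -> lattice_generic p ->
  {for p, continuous (@Lseq R ^~ n)}.
Proof.
move=> Tp gp; suff [] : {for p, continuous (@Lseq R ^~ n)} /\
  {for p, continuous (@Lseq R ^~ n.+1)} by [].
elim: n => [|n [cont_n cont_n1]]; first by split; [exact: cvg_fst|exact: cvg_snd].
split=> //; rewrite /prop_for /continuous_at LseqSS.
have kE := near_kidx Tp gp cont_n cont_n1.
apply: cvg_trans (_ : (kidx p n)%:~R * Lseq q n.+1 - Lseq q n @[q --> p] --> _).
  by apply: near_eq_cvg; near=> q; rewrite LseqSS (near kE q).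
by apply: cvgB => //; apply: cvgM => //; exact: cvg_cst.
Unshelve. all: by end_near. Qed.

Definition kidx_tuple (s : nat) p : s.-tuple nat := [tuple `|kidx p i|%N | i < s].

Lemma near_kidx_tuple s p : fareyT p -> lattice_generic p ->
  \forall q \near p, kidx_tuple s q = kidx_tuple s p.
Proof.
move=> Tp gp; have near_all : \forall q \near p, forall i : 'I_s, kidx q i = kidx p i.
  apply: (@filter_forall _ 'I_s (fun i q => kidx q i = kidx p i) (nbhs p)) => i.
  by apply: near_kidx => //; exact: continuous_Lseq.
by apply: filterS near_all => q qE; apply: eq_from_tnth => i; rewrite !tnth_mktuple qE.
Qed.

Lemma fareyTkP s (k : s.-tuple nat) p : fareyTk R k p <-> fareyT p /\ kidx_tuple s p = k.
Proof.
split=> -[Tp kE]; split=> //.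
  by apply: eq_from_tnth => j; rewrite tnth_mktuple kE.
by move=> j; rewrite -kE tnth_mktuple gez0_abs // kidx_ge0.
Qed.

Lemma measurable_fareyT : measurable (@fareyT R).
Proof.
rewrite (_ : @fareyT R = unit_square R `&` ((fun p => p.1 + p.2) @^-1` `]1, +oo[)).
  apply: measurableI; first exact: measurable_unit_square.
  have madd : measurable_fun setT (fun p : R * R => p.1 + p.2).
    exact: measurable_funD.
  by have := madd measurableT _ (measurable_itv `]1, +oo[); rewrite setTI.
apply/seteqP; split=> p; rewrite /unit_square /= !in_itv /= andbT; first by case.
by move=> [[? ?] ?]; split.
Qed.

Lemma measurable_fareyTk s (k : s.-tuple nat) : measurable (fareyTk R k).
Proof.
have -> : fareyTk R k = @fareyT R `&` \bigcap_(j in [set: 'I_s])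
    ((fun p => (kidx p j)%:~R : R) @^-1` [set (tnth k j)%:R]).
  apply/seteqP; split=> p [Tp kE]; split=> // j; first by move=> _; rewrite /= kE.
  by have /eqP := kE j Logic.I; rewrite pmulrn eqr_int => /eqP.
apply: measurableI; first exact: measurable_fareyT.
apply: fin_bigcap_measurable; first exact: finite_finset.
move=> j _; have := measurable_kidx j measurableT (measurable_set1 (tnth k j)%:R).
by rewrite setTI.
Qed.

Definition region s (P : set (s.-tuple nat)) : set (R * R) :=
  [set p | fareyT p /\ P (kidx_tuple s p)].

Lemma region_fareyTk s (P : set (s.-tuple nat)) : region P = \bigcup_(k in P) fareyTk R k.
Proof.
apply/seteqP; split=> p.
  by move=> [Tp Pp]; exists (kidx_tuple s p) => //; apply/fareyTkP.
by move=> [k Pk /fareyTkP[Tp kE]]; split; rewrite ?kE.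
Qed.

Lemma region_sub s (P : set (s.-tuple nat)) : region P `<=` unit_square R.
Proof. by move=> p [/fareyT_sub]. Qed.

Lemma measurable_region s (P : set (s.-tuple nat)) : measurable (region P).
Proof.
rewrite region_fareyTk bigcup_mkcond; apply: countable_bigcupT_measurable.
  exact: countableP.
by move=> k; case: ifP => // _; exact: measurable_fareyTk.
Qed.

Lemma area_region s (P : set (s.-tuple nat)) :
  mu (region P) = (\esum_(k in P) area (fareyTk R k))%E.
Proof.
rewrite region_fareyTk; apply: measure_bigcup_countType; first exact: measurable_fareyTk.
by move=> k l _ _ [p [/fareyTkP[_ <-] /fareyTkP[_ <-]]].
Qed.

Lemma near_region s (P : set (s.-tuple nat)) p : lattice_generic p ->
  \forall q \near p, region P q <-> region P p.
Proof.
move=> gp; have [Tp|nTp] := pselect (fareyT p).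
  near=> q; have Tq : fareyT q by apply/(near (near_fareyT gp) q).
  rewrite /region /= (near (near_kidx_tuple s Tp gp) q) //; tauto.
near=> q; have Tq := near (near_fareyT gp) q.
by split=> -[Tpq _]; case: nTp => //; apply/Tq.
Unshelve. all: by end_near. Qed.

Lemma negligible_frontier_region s (P : set (s.-tuple nat)) :
  mu.-negligible (closure (region P) `\` (region P)°).
Proof.
apply: negligibleS negligible_not_lattice_generic => p [cl_p nint_p] gp.
have near_p := near_region P gp.
have [Pp|nPp] := pselect (region P p).
  by apply: nint_p; apply: filterS near_p => q [_ /(_ Pp)].
by have [q [Pq [/(_ Pq)]]] := cl_p _ near_p.
Qed.

End FareyTriangle.

Arguments region R {s} P.

Section AreaFareyTriangle.
Variable R : realType.
Local Notation mu := (@lebesgue_measure R \x @lebesgue_measure R)%E.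

Lemma integral_id (a b : R) : a < b ->
  (\int[@lebesgue_measure R]_(x in `[a, b]) x%:E = ((b ^+ 2 - a ^+ 2) / 2)%:E)%E.
Proof.
move=> ab; pose F (x : R) := x ^+ 2 / 2.
have dF (x : R) : is_derive x 1 F x.
  by apply: is_derive_eq; rewrite /GRing.scale /=; field.
have cF : continuous F.
  by move=> x; apply: differentiable_continuous; apply/derivable1_diffP; exact: ex_derive.
rewrite (@continuous_FTC2 R id F) //.
- by rewrite /F -EFinB mulrBl.
- by apply: continuous_subspaceT => x; exact: cvg_id.
- split=> [x _||]; first exact: ex_derive.
    by apply: cvg_at_right_filter; exact: cF.
  by apply: cvg_at_left_filter; exact: cF.
- by move=> x _; rewrite derive1E; exact: derive_val.
Qed.

Lemma measure_xsection_fareyT (x : R) :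
  @lebesgue_measure R (xsection (@fareyT R) x) = (if 0 < x <= 1 then x else 0)%:E.
Proof.
case: ifP => [/andP[x0 x1]|x01]; last first.
  rewrite (_ : xsection _ _ = set0) ?measure0 // -subset0 => y.
  by rewrite /xsection /= inE => -[/=]; rewrite x01.
have -> : xsection (@fareyT R) x = [set` `]1 - x, 1]%R].
  apply/seteqP; split=> y; rewrite /xsection /= inE /fareyT /= in_itv /=.
    by move=> [_ /andP[_ ->] xy]; rewrite andbT ltrBlDl.
  by move=> /andP[y_gt y1]; split; [rewrite x0|rewrite y1 andbT|]; lra.
rewrite lebesgue_measure_itv /= lte_fin ltrBlDr ltrDl x0.
by rewrite -EFinB opprB addrC subrK.
Qed.

Lemma area_fareyT : mu (@fareyT R) = (2^-1)%:E.
Proof.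
have <- : (\int[@lebesgue_measure R]_(x in `[0%R, 1%R]) x%:E = (2^-1)%:E)%E.
  by rewrite integral_id // expr1n expr0n subr0 mul1r.
rewrite -integral_itv_obnd_cbnd; last exact/measurable_EFinP/measurable_id.
rewrite [LHS]/product_measure1 [RHS]integral_mkcond; apply: eq_integral => x _ /=.
rewrite patchE measure_xsection_fareyT mem_setE in_itv /=.
by case: ifP.
Qed.

Lemma region_setT s : region R [set: s.-tuple nat] = @fareyT R.
Proof. by apply/seteqP; split=> p // -[]. Qed.

End AreaFareyTriangle.

(** * Lattice points of the dilated triangle *)

Definition in_fareyT (Q : nat) : rel nat :=
  [rel a b | [&& 0 < a, a <= Q, 0 < b, b <= Q & Q < a + b]%N].

Definition farey_pair (Q : nat) : rel nat := [rel a b | in_fareyT Q a b && coprime a b].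

Lemma lattice_ptP Q a b : reflect (lattice_pt Q a b) (farey_pair Q a b).
Proof.
apply: (iffP andP) => [[/and5P[a0 aQ b0 bQ ab] cop]|[/andP[a0 aQ] /andP[b0 bQ] ab cop]].
  by split; rewrite ?a0 ?b0.
by rewrite /in_fareyT /= a0 aQ b0 bQ ab.
Qed.

Section LatticeIteration.
Variables Q a b : nat.
Hypothesis abT : in_fareyT Q a b.

Lemma in_fareyT_gt0 : (0 < Q)%N.
Proof. by case/and5P: abT => a0 aQ _ _ _; exact: leq_trans aQ. Qed.

Lemma qseq_step n : in_fareyT Q (qseq Q a b n) (qseq Q a b n.+1) ->
  in_fareyT Q (qseq Q a b n.+1) (qseq Q a b n.+2) /\
  (qseq Q a b n.+2 + qseq Q a b n = kseq Q a b n * qseq Q a b n.+1)%N.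
Proof.
rewrite -[qseq Q a b n.+2]/(kseq Q a b n * qseq Q a b n.+1 - qseq Q a b n)%N /kseq.
move: (qseq _ _ _ n) (qseq _ _ _ n.+1) => u v /and5P[u0 uQ v0 vQ uv].
have := (leq_trunc_div (Q + u) v, ltn_ceil (Q + u) v0).
by rewrite /in_fareyT /= mulSn; move: (_ %/ _ * v)%N => t [? ?]; lia.
Qed.

Lemma in_fareyT_qseq n : in_fareyT Q (qseq Q a b n) (qseq Q a b n.+1).
Proof. by elim: n => [|n /qseq_step[]]. Qed.

Lemma qseq_rec n : (qseq Q a b n.+2 + qseq Q a b n = kseq Q a b n * qseq Q a b n.+1)%N.
Proof. by have [] := qseq_step (in_fareyT_qseq n). Qed.

Lemma qseq_gt0 n : (0 < qseq Q a b n)%N.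
Proof. by case/and5P: (in_fareyT_qseq n). Qed.

Lemma kseq_gt0 n : (0 < kseq Q a b n)%N.
Proof.
have /and5P[_ _ v0 vQ _] := in_fareyT_qseq n.
by rewrite divn_gt0 // (leq_trans vQ) ?leq_addr.
Qed.

End LatticeIteration.

Definition kseq_tuple (s Q a b : nat) : s.-tuple nat := [tuple kseq Q a b i | i < s].

Section ScaledLattice.
Variable R : realType.
Local Notation mu := (@lebesgue_measure R \x @lebesgue_measure R)%E.

Definition scaled_pt (Q a b : nat) : R * R := (a%:R / Q%:R, b%:R / Q%:R).

Lemma fareyT_scaled_pt Q a b : (0 < Q)%N -> fareyT (scaled_pt Q a b) <-> in_fareyT Q a b.
Proof.
move=> Q0; have Q0' : 0 < Q%:R :> R by rewrite ltr0n.
rewrite /fareyT /in_fareyT /= -mulrDl -natrD !pmulr_lgt0 ?invr_gt0 // !ltr0n.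
rewrite !ler_pdivrMr // !ltr_pdivlMr // !mul1r !ler_nat !ltr_nat.
by split=> [[/andP[-> ->] /andP[-> ->] ->]//|/and5P[-> -> -> -> ->]].
Qed.

Lemma floor_scaled Q u v : (0 < Q)%N -> (0 < v)%N ->
  Num.floor ((1 + u%:R / Q%:R) / (v%:R / Q%:R) : R) = ((Q + u) %/ v)%N%:Z.
Proof.
move=> Q0 v0; have [Q0' v0'] : 0 < Q%:R :> R /\ 0 < v%:R :> R by rewrite !ltr0n.
have -> : (1 + u%:R / Q%:R) / (v%:R / Q%:R) = (Q + u)%:R / v%:R :> R.
  by rewrite natrD; field; rewrite !gt_eqF.
apply: floor_def; rewrite ler_pdivlMr // ltr_pdivrMr // intrD -!pmulrn.
by rewrite -natrD -!natrM ler_nat ltr_nat leq_trunc_div addn1 ltn_ceil.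
Qed.

Lemma Lseq_scaled_pt Q a b n : in_fareyT Q a b ->
  Lseq (scaled_pt Q a b) n = (qseq Q a b n)%:R / Q%:R.
Proof.
move=> abT; have Q0 := in_fareyT_gt0 abT.
suff [] : Lseq (scaled_pt Q a b) n = (qseq Q a b n)%:R / Q%:R /\
          Lseq (scaled_pt Q a b) n.+1 = (qseq Q a b n.+1)%:R / Q%:R by [].
elim: n => [//|n [Ln Ln1]]; split=> //.
rewrite LseqSS /kidx Ln Ln1 floor_scaled ?qseq_gt0 // -/(kseq Q a b n) -pmulrn.
by rewrite mulrA -mulrBl -natrM -qseq_rec // natrD addrK.
Qed.

Lemma kidx_scaled_pt Q a b n : in_fareyT Q a b ->
  kidx (scaled_pt Q a b) n = (kseq Q a b n)%:Z.
Proof.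
move=> abT; rewrite /kidx !Lseq_scaled_pt // floor_scaled ?qseq_gt0 //.
exact: in_fareyT_gt0 abT.
Qed.

Lemma region_scaled_pt s (P : set (s.-tuple nat)) Q a b : (0 < Q)%N ->
  region R P (scaled_pt Q a b) <-> in_fareyT Q a b /\ P (kseq_tuple s Q a b).
Proof.
move=> Q0; have kE : in_fareyT Q a b -> kidx_tuple s (scaled_pt Q a b) = kseq_tuple s Q a b.
  by move=> abT; apply: eq_from_tnth => j; rewrite !tnth_mktuple kidx_scaled_pt.
split=> [[/(fareyT_scaled_pt _ _ Q0) abT Pk]|[abT Pk]]; first by rewrite -kE.
by split; [exact/fareyT_scaled_pt|rewrite kE].
Qed.

Lemma dyadic_square_scaled_pt n i j Q a b : (0 < Q)%N ->
  dyadic_square n i j (scaled_pt Q a b) <-> in_box (2 ^ n) i j Q a b.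
Proof.
move=> Q0; have [Q0' D0] : 0 < Q%:R :> R /\ 0 < (2 ^ n)%:R :> R by rewrite !ltr0n expn_gt0.
have itv_cell k c : (c%:R / Q%:R \in `](k%:R / (2 ^ n)%:R : R), k.+1%:R / (2 ^ n)%:R]) =
    cell (2 ^ n) k Q c.
  rewrite in_itv /= ltr_pdivlMr // mulrAC ltr_pdivrMr // -!natrM ltr_nat.
  by rewrite ler_pdivrMr // mulrAC ler_pdivlMr // -!natrM ler_nat.
rewrite /dyadic_square /dyadic_ocitv /= !itv_cell.
by split=> [[? ?]|/andP[]//]; apply/andP.
Qed.

Definition parity_mass (e : bool * bool) (Q : nat) (A : set (R * R)) : R :=
  lattice_density R Q
    [rel a b | primitive (parity_class e) a b && `[< A (scaled_pt Q a b) >]].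

Lemma parity_mass_additive e Q A B : A `&` B = set0 ->
  parity_mass e Q (A `|` B) = parity_mass e Q A + parity_mass e Q B.
Proof.
move=> AB0; rewrite /parity_mass /lattice_density -mulrDl -natrD; congr (_%:R / _).
rewrite -big_split; apply: eq_bigr => -[a b] _ /=.
have notAB : ~ (A (scaled_pt Q a b) /\ B (scaled_pt Q a b)).
  by move=> ABp; have : (A `&` B) (scaled_pt Q a b) by []; rewrite AB0.
rewrite [`[< _ >]]asbool_or; case: (primitive _ a b) => //=.
have [Ap|] := asboolP (A _); have [Bp|] := asboolP (B _) => //=.
by case: notAB.
Qed.

Lemma equidistributed_parity e n i j : e != (false, false) ->
  (i < 2 ^ n)%N -> (j < 2 ^ n)%N ->
  equidistributed (parity_mass e) (parity_density R) (dyadic_square n i j).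
Proof.
move=> e0 iD jD; rewrite /equidistributed area_dyadic_square /=.
apply: cvg_trans (@cvg_box_parity_density R (2 ^ n) i j e _ iD jD e0); last first.
  by rewrite expn_gt0.
apply: near_eq_cvg; near=> Q; have Q0 : (0 < Q)%N by near: Q; exact: nbhs_infty_gt.
congr (_%:R / _); apply: eq_lattice_count => a b _ _ /=; rewrite andbC; congr andb.
by apply/idP/asboolP => /(dyadic_square_scaled_pt _ _ _ _ _ Q0).
Unshelve. all: by end_near. Qed.

Lemma cvg_region_parity_density s (P : set (s.-tuple nat)) e : e != (false, false) ->
  lattice_density R Q [rel a b | [&& farey_pair Q a b, parity_class e a b &
    `[< P (kseq_tuple s Q a b) >]]] @[Q --> \oo] -->
  parity_density R * fine (mu (region R P)).
Proof.
move=> e0; have eq_region : equidistributed (parity_mass e) (parity_density R) (region R P).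
  apply: equidistributed_jordan.
  - by move=> Q A; rewrite /parity_mass /lattice_density divr_ge0 ?sqr_ge0.
  - exact: parity_mass_additive.
  - by move=> n i j; exact: equidistributed_parity.
  - exact: measurable_region.
  - exact: region_sub.
  - exact: negligible_frontier_region.
apply: cvg_trans eq_region; apply: near_eq_cvg; near=> Q.
have Q0 : (0 < Q)%N by near: Q; exact: nbhs_infty_gt.
congr (_%:R / _); apply: eq_lattice_count => a b _ _.
apply/andP/and3P => [[/and4P[_ _ cop e_ab] /asboolP/(region_scaled_pt _ _ _ Q0)[abT Pk]]|].
  by split=> //; [apply/andP|exact/asboolP].
move=> [/andP[abT cop] e_ab /asboolP Pk]; split; last exact/asboolP/region_scaled_pt.
by case/and5P: (abT) => a0 _ b0 _ _; apply/and4P.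
Unshelve. all: by end_near. Qed.

End ScaledLattice.

(** * Neighbours in the Farey sequence *)

(* [a' / q' - a / q = 1 / (q * q')], freed of subtraction. *)
Definition unimodular (a q a' q' : nat) : Prop := (a' * q = a * q' + 1)%N.

Lemma unimodular_coprime_denom a q a' q' : unimodular a q a' q' -> coprime q q'.
Proof.
move=> uni; rewrite /coprime -dvdn1 -(dvdn_addr (m := a * q')) -?uni.
  by rewrite dvdn_mull ?dvdn_gcdl.
by rewrite dvdn_mull ?dvdn_gcdr.
Qed.

Lemma unimodular_coprimel a q a' q' : unimodular a q a' q' -> coprime a q.
Proof.
move=> uni; rewrite coprime_sym; apply: (@unimodular_coprime_denom q' q a' a).
by rewrite /unimodular uni mulnC.
Qed.

Lemma unimodular_coprimer a q a' q' : unimodular a q a' q' -> coprime a' q'.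
Proof.
by move=> uni; apply: (@unimodular_coprime_denom a a' q q'); rewrite /unimodular mulnC.
Qed.

Lemma unimodular_numer_le a q a' q' :
  unimodular a q a' q' -> (a < q)%N -> (0 < q')%N -> (a' <= q')%N.
Proof. by rewrite /unimodular => uni aq q'0; nia. Qed.

Lemma unimodular_between_denom_ge a q a' q' b d : unimodular a q a' q' ->
  (a * d < b * q)%N -> (b * q' < a' * d)%N -> (q + q' <= d)%N.
Proof.
move=> uni lt_l lt_r.
have : (q' * (a * d).+1 <= q' * (b * q))%N by rewrite leq_mul2l lt_l orbT.
have : (q * (b * q').+1 <= q * (a' * d))%N by rewrite leq_mul2l lt_r orbT.
have : (d * (a' * q) = d * (a * q' + 1))%N by rewrite uni.
lia.
Qed.

Lemma unimodular_numer_inj a q a' b b' q' : unimodular a q a' q' -> unimodular b q b' q' ->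
  (a < q)%N -> (b < q)%N -> a = b.
Proof.
wlog ab : a a' b b' / (a <= b)%N.
  move=> le_case ua ub aq bq; case/orP: (leq_total a b) => [ab|ba].
    exact: le_case ab ua ub aq bq.
  by symmetry; exact: le_case ba ub ua bq aq.
move=> ua ub aq bq; have : (q %| b - a)%N.
  rewrite -(Gauss_dvdl _ (unimodular_coprime_denom ua)).
  have -> : ((b - a) * q' = (b' - a') * q)%N by rewrite !mulnBl ua ub subnDr.
  exact: dvdn_mull.
by case: (posnP (b - a)) => [|ab0 /(dvdn_leq ab0)]; lia.
Qed.

Lemma unimodular_exists q q' : (0 < q)%N -> coprime q q' ->
  exists a a', (a < q)%N /\ unimodular a q a' q'.
Proof.
move=> q0 /eqP cop; have [a aq] := Bezoutl q' q0; rewrite cop => q_dvd.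
by exists a, ((1 + a * q') %/ q)%N; split=> //; rewrite /unimodular divnK // addnC.
Qed.

Lemma unimodular_successor Q a q : coprime a q -> (a < q)%N -> (q <= Q)%N ->
  exists a' q', [/\ unimodular a q a' q', (0 < q')%N, (q' <= Q)%N & (Q < q + q')%N].
Proof.
move=> /eqP cop aq qQ; have q0 : (0 < q)%N by exact: leq_ltn_trans aq.
have [u uq] := Bezoutl a q0; rewrite gcdnC cop => q_dvd.
have := (leq_trunc_div (Q - u) q, ltn_ceil (Q - u) q0); rewrite mulSn.
set t := ((Q - u) %/ q)%N => -[tq_le tq_gt].
exists ((1 + u * a) %/ q + t * a)%N, (u + t * q)%N.
split; [|lia..]; rewrite /unimodular mulnDl divnK //; lia.
Qed.

Definition nat_frac (a q : nat) : rat := a%:R / q%:R.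

Lemma nat_frac_lt a q b d : (0 < q)%N -> (0 < d)%N ->
  (nat_frac a q < nat_frac b d) = (a * d < b * q)%N.
Proof.
move=> q0 d0; rewrite /nat_frac ltr_pdivrMr ?ltr0n // mulrAC ltr_pdivlMr ?ltr0n //.
by rewrite -!natrM ltr_nat.
Qed.

Lemma denq_nat_frac a q : (0 < q)%N -> coprime a q -> `|denq (nat_frac a q)|%N = q.
Proof.
move=> q0 cop; rewrite /nat_frac !pmulrn coprimeq_den /= ?absz_nat //.
by rewrite ifF //; apply/negbTE; rewrite -lt0n.
Qed.

Lemma numq_nat_frac a q : (0 < q)%N -> coprime a q -> `|numq (nat_frac a q)|%N = a.
Proof.
move=> q0 cop; rewrite /nat_frac !pmulrn coprimeq_num /= ?absz_nat //.
by rewrite gtr0_sg ?mul1r.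
Qed.

Lemma mem_farey Q x : reflect
  (exists a q, [/\ (0 < q <= Q)%N, (a <= q)%N, coprime a q & x = nat_frac a q])
  (x \in farey Q).
Proof.
rewrite mem_sort.
apply: (iffP allpairsPdep) => [[q [a [q_Q aq ->]]]|[a [q [q_Q aq cop ->]]]].
  move: q_Q aq; rewrite mem_iota add1n ltnS mem_filter mem_iota add0n ltnS /=.
  by move=> q_Q /andP[cop aq]; exists a, q.
by exists q, a; split => //; rewrite ?mem_filter ?mem_iota ?add1n ?ltnS //= cop.
Qed.

Lemma farey_uniq Q : uniq (farey Q).
Proof.
rewrite sort_uniq; apply: allpairs_uniq_dep => [|q _|]; first exact: iota_uniq.
  by rewrite filter_uniq // iota_uniq.
move=> _ _ /allpairsPdep[q [a [+ + ->]]] /allpairsPdep[d [b [+ + ->]]] /=.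
rewrite !mem_iota !mem_filter => /andP[q0 _] /andP[cop_a _] /andP[d0 _] /andP[cop_b _] fracE.
have qd : q = d.
  by rewrite -(denq_nat_frac q0 cop_a) -(denq_nat_frac d0 cop_b) /nat_frac fracE.
have ab : a = b.
  by rewrite -(numq_nat_frac q0 cop_a) -(numq_nat_frac d0 cop_b) /nat_frac fracE.
by rewrite qd ab.
Qed.

Lemma farey_sorted Q : sorted <%R (farey Q).
Proof. by rewrite lt_sorted_uniq_le farey_uniq sort_le_sorted. Qed.

Definition farey_denom (Q i : nat) : nat := nth 0%N (farey_den Q) i.

Definition farey_numer (Q i : nat) : nat := `|numq (nth 0%R (farey Q) i)|%N.

Section FareyEntry.
Variables Q i : nat.
Hypothesis iQ : (i < size (farey Q))%N.

Lemma farey_entryE a q : (0 < q)%N -> coprime a q -> nth 0 (farey Q) i = nat_frac a q ->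
  farey_denom Q i = q /\ farey_numer Q i = a.
Proof.
move=> q0 cop fracE; rewrite /farey_denom /farey_numer (nth_map 0) // fracE.
by rewrite denq_nat_frac ?numq_nat_frac.
Qed.

Lemma farey_entryP :
  [/\ (0 < farey_denom Q i <= Q)%N, (farey_numer Q i <= farey_denom Q i)%N,
      coprime (farey_numer Q i) (farey_denom Q i)
    & nth 0 (farey Q) i = nat_frac (farey_numer Q i) (farey_denom Q i)].
Proof.
have /mem_farey[a [q [/andP[q0 qQ] aq cop fracE]]] := mem_nth 0 iQ.
by have [-> ->] := farey_entryE q0 cop fracE; rewrite q0.
Qed.

End FareyEntry.

Lemma sorted_nth_succ d (T : orderType d) (x0 : T) (s : seq T) i y :
  sorted <%O s -> (i < size s)%N -> y \in s -> (nth x0 s i < y)%O ->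
  (forall z, z \in s -> (nth x0 s i < z)%O -> ~~ (z < y)%O) ->
  (i.+1 < size s)%N /\ nth x0 s i.+1 = y.
Proof.
move=> s_sorted i_s y_s; have idx_s : (index y s < size s)%N by rewrite index_mem.
have nth_lt u v : (u < size s)%N -> (v < size s)%N ->
    (nth x0 s u < nth x0 s v)%O = (u < v)%N.
  by move=> us vs; rewrite lt_sorted_ltn_nth.
move=> lt_y no_between; have i_idx : (i < index y s)%N by rewrite -nth_lt ?nth_index.
have i1_s : (i.+1 < size s)%N by exact: leq_ltn_trans idx_s.
split=> //; move: i_idx; rewrite leq_eqVlt => /orP[/eqP ->|i1_idx]; first exact: nth_index.
have := no_between _ (mem_nth x0 i1_s); rewrite nth_lt // ltnSn => /(_ isT).
by rewrite -{1}(nth_index x0 y_s) nth_lt // i1_idx.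
Qed.

Lemma farey_succ Q i a' q' : (i < size (farey Q))%N ->
  unimodular (farey_numer Q i) (farey_denom Q i) a' q' ->
  (farey_numer Q i < farey_denom Q i)%N -> (0 < q' <= Q)%N -> (Q < farey_denom Q i + q')%N ->
  [/\ (i.+1 < size (farey Q))%N, farey_denom Q i.+1 = q' & farey_numer Q i.+1 = a'].
Proof.
move=> iQ uni aq /andP[q'0 q'Q] Qq.
have [/andP[q0 qQ] _ cop iE] := farey_entryP iQ.
have a'q' := unimodular_numer_le uni aq q'0; have cop' := unimodular_coprimer uni.
have [|||i1 i1E] :=
  @sorted_nth_succ _ _ 0 (farey Q) i (nat_frac a' q') (farey_sorted Q) iQ.
- by apply/mem_farey; exists a', q'; rewrite q'0.
- by rewrite iE nat_frac_lt // uni addn1.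
- move=> z /mem_farey[b [d [/andP[d0 dQ] bd cop_b ->]]].
  rewrite iE !nat_frac_lt // => lt_l; apply/negP => lt_r.
  by have := unimodular_between_denom_ge uni lt_l lt_r; lia.
by have [-> ->] := farey_entryE i1 q'0 cop' i1E.
Qed.

Lemma farey_unimodular Q i : (i.+1 < size (farey Q))%N ->
  [/\ unimodular (farey_numer Q i) (farey_denom Q i)
        (farey_numer Q i.+1) (farey_denom Q i.+1),
      (farey_numer Q i < farey_denom Q i)%N
    & in_fareyT Q (farey_denom Q i) (farey_denom Q i.+1)].
Proof.
move=> i1; have iQ := ltnW i1.
have [/andP[q0 qQ] aq cop iE] := farey_entryP iQ.
have [/andP[q0' qQ'] aq' cop' i1E] := farey_entryP i1.
have a_lt : (farey_numer Q i < farey_denom Q i)%N.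
  have : nth 0 (farey Q) i < nth 0 (farey Q) i.+1.
    by rewrite lt_sorted_ltn_nth // farey_sorted.
  by rewrite iE i1E nat_frac_lt //; nia.
have [a' [q' [uni q'0 q'Q Qq]]] := unimodular_successor cop a_lt qQ.
have [|_ -> ->] := farey_succ iQ uni a_lt _ Qq; first by rewrite q'0.
by split=> //; apply/and5P.
Qed.

Lemma farey_denom_next Q i : (i.+2 < size (farey Q))%N ->
  farey_denom Q i.+2 =
  ((Q + farey_denom Q i) %/ farey_denom Q i.+1 * farey_denom Q i.+1 - farey_denom Q i)%N.
Proof.
move=> i2; have [uni _ iT] := farey_unimodular (ltnW i2).
have [uni' _ i1T] := farey_unimodular i2; have [_ _ cop _] := farey_entryP (ltnW i2).
have /dvdnP[k sumE] : (farey_denom Q i.+1 %| farey_denom Q i + farey_denom Q i.+2)%N.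
  rewrite -(Gauss_dvdr (n := farey_numer Q i.+1)) 1?coprime_sym //.
  have -> : (farey_numer Q i.+1 * (farey_denom Q i + farey_denom Q i.+2) =
             farey_denom Q i.+1 * (farey_numer Q i + farey_numer Q i.+2))%N.
    by move: uni uni'; rewrite /unimodular; lia.
  exact: dvdn_mulr.
suff -> : ((Q + farey_denom Q i) %/ farey_denom Q i.+1)%N = k by lia.
move: iT i1T => /and5P[_ _ q1 _ _] /and5P[_ _ q2 q2Q q12].
apply/eqP; rewrite eqn_leq -ltnS ltn_divLR // leq_divRL //.
by rewrite mulSn -sumE; lia.
Qed.

Lemma farey_denom_qseq Q i j : (i.+1 < size (farey Q))%N -> (i + j < size (farey Q))%N ->
  farey_denom Q (i + j) = qseq Q (farey_denom Q i) (farey_denom Q i.+1) j.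
Proof.
move=> i1; elim/ltn_ind: j => -[|[|j]] IHj; rewrite ?addn0 ?addn1 // !addnS => ij.
by rewrite farey_denom_next // -!addnS !IHj //; lia.
Qed.

Lemma farey_denom_pair_inj Q i j : (i.+1 < size (farey Q))%N -> (j.+1 < size (farey Q))%N ->
  farey_denom Q i = farey_denom Q j -> farey_denom Q i.+1 = farey_denom Q j.+1 -> i = j.
Proof.
move=> i1 j1 qE q'E; have [uni aq _] := farey_unimodular i1.
have [] := farey_unimodular j1; rewrite -qE -q'E => uni' bq _.
have aE := unimodular_numer_inj uni uni' aq bq.
have [[_ _ _ iE] [_ _ _ jE]] := (farey_entryP (ltnW i1), farey_entryP (ltnW j1)).
have : nth 0 (farey Q) i = nth 0 (farey Q) j by rewrite iE jE aE qE.
by move/eqP; rewrite nth_uniq ?farey_uniq ?(ltnW i1) ?(ltnW j1) // => /eqP.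
Qed.

Lemma farey_denom_pair_surj Q q q' : farey_pair Q q q' ->
  exists i, [/\ (i.+1 < size (farey Q))%N, farey_denom Q i = q & farey_denom Q i.+1 = q'].
Proof.
move=> /andP[/and5P[q0 qQ q'0 q'Q Qq] cop]; have [a [a' [aq uni]]] := unimodular_exists q0 cop.
have cop_a := unimodular_coprimel uni.
have fracF : nat_frac a q \in farey Q.
  by apply/mem_farey; exists a, q; split=> //; [rewrite q0|exact: ltnW].
pose i := index (nat_frac a q) (farey Q).
have iQ : (i < size (farey Q))%N by rewrite index_mem.
have [dE nE] := farey_entryE iQ q0 cop_a (nth_index 0 fracF).
have [||||i1 i1E _] := @farey_succ Q i a' q' iQ; rewrite ?dE ?nE ?q'0 //.
by exists i.
Qed.

Definition farey_denom_pairs (Q : nat) : seq (nat * nat) :=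
  [seq (farey_denom Q i, farey_denom Q i.+1) | i <- iota 0 (size (farey Q)).-1].

Lemma farey_denom_pairs_uniq Q : uniq (farey_denom_pairs Q).
Proof.
rewrite map_inj_in_uniq ?iota_uniq // => i j; rewrite !mem_iota => iQ jQ [dE d'E].
by apply: farey_denom_pair_inj dE d'E; lia.
Qed.

Lemma mem_farey_denom_pairs Q a b :
  ((a, b) \in farey_denom_pairs Q) = farey_pair Q a b.
Proof.
apply/mapP/idP => [[i]|/farey_denom_pair_surj[i [i1 <- <-]]].
  rewrite mem_iota => iQ [-> ->]; have [|uni _ iT] := @farey_unimodular Q i; first by lia.
  by rewrite /farey_pair /= iT; exact: unimodular_coprime_denom uni.
by exists i; rewrite // mem_iota; lia.
Qed.

Lemma count_farey_pairs Q (S : rel nat) :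
  count (fun i => S (farey_denom Q i) (farey_denom Q i.+1)) (iota 0 (size (farey Q)).-1) =
  lattice_count Q [rel a b | farey_pair Q a b && S a b].
Proof.
rewrite (@lattice_count_seq _ _ [seq p <- farey_denom_pairs Q | S p.1 p.2]).
- by rewrite size_filter count_map.
- by rewrite filter_uniq // farey_denom_pairs_uniq.
- move=> a b; rewrite mem_filter mem_farey_denom_pairs andbC /farey_pair /in_fareyT /=.
  by case: (a <= Q)%N (b <= Q)%N => [] []; rewrite ?andbF.
Qed.

Lemma size_farey_gt1 Q : (0 < Q)%N -> (1 < size (farey Q))%N.
Proof.
move=> Q0; have : farey_pair Q 1 Q by rewrite /farey_pair /in_fareyT /= coprime1n; lia.
by move=> /farey_denom_pair_surj[i [i1 _ _]]; lia.
Qed.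

(** * Parities of consecutive denominators *)

Lemma eqn_mod2_odd m n : (m == n %[mod 2]) = (odd m == odd n).
Proof. by rewrite !modn2; case: (odd m) (odd n) => [] []. Qed.

Lemma congr_mod2P r (c : r.-tuple nat) (q : nat -> nat) :
  congr_mod 2 q c <-> forall j, (j < r)%N -> odd (q j) = odd (nth 0%N c j).
Proof.
split=> [qc j jr|qc j].
  by have /eqP := qc (Ordinal jr); rewrite eqn_mod2_odd (tnth_nth 0%N) => /eqP.
by apply/eqP; rewrite eqn_mod2_odd (tnth_nth 0%N) qc.
Qed.

Lemma odd_qseq Q a b n : in_fareyT Q a b ->
  odd (qseq Q a b n.+2) =
  (odd (kseq Q a b n) && odd (qseq Q a b n.+1)) (+) odd (qseq Q a b n).
Proof.
by move=> /qseq_rec/(_ n)/(congr1 odd); rewrite oddD oddM => <-; rewrite -addbA addbb addbF.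
Qed.

Lemma odd_qseq_eq s Q a b Q' a' b' : in_fareyT Q a b -> in_fareyT Q' a' b' ->
  odd a = odd a' -> odd b = odd b' ->
  (forall j, (j < s)%N -> kseq Q a b j = kseq Q' a' b' j) ->
  forall j, (j < s.+2)%N -> odd (qseq Q a b j) = odd (qseq Q' a' b' j).
Proof.
move=> abT abT' aE bE kE; elim/ltn_ind => -[|[|j]] IHj js //.
by rewrite (odd_qseq j abT) (odd_qseq j abT') kE // !IHj //; lia.
Qed.

Lemma Kset_kseq_tuple d r (c : r.-tuple nat) Q a b : farey_pair Q a b ->
  congr_mod d (qseq Q a b) c -> Kset c d (kseq_tuple (r - 2) Q a b).
Proof.
move=> pair_ab qc; have /andP[abT _] := pair_ab; have Q0 := in_fareyT_gt0 abT.
have lat : lattice_pt Q a b by exact/lattice_ptP.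
have kE : has_kvec Q a b (kseq_tuple (r - 2) Q a b) by move=> j; rewrite tnth_mktuple.
split; last by exists Q, a, b.
by split=> [j|]; [rewrite tnth_mktuple kseq_gt0|exists Q, a, b].
Qed.

Definition first_parities r (c : r.-tuple nat) : bool * bool :=
  (odd (nth 0%N c 0), odd (nth 0%N c 1)).

Lemma congr_qseq_Kset r (c : r.-tuple nat) Q a b : (2 <= r)%N -> farey_pair Q a b ->
  congr_mod 2 (qseq Q a b) c <->
  parity_class (first_parities c) a b /\ Kset c 2 (kseq_tuple (r - 2) Q a b).
Proof.
move=> r2 pair_ab; split=> [qc|[/eqP[aE bE] [_ [Q' [a' [b' [_ lat' kE]]]]]]].
  split; last exact: Kset_kseq_tuple.
  have /congr_mod2P qc' := qc.
  by rewrite /parity_class /first_parities /= -(qc' 0%N (ltnW r2)) -(qc' 1%N r2).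
have [/andP[abT _] /lattice_ptP/andP[abT' _]] := (pair_ab, lat').
move=> /congr_mod2P qc'; apply/congr_mod2P => j jr; rewrite -qc' //.
apply: (@odd_qseq_eq (r - 2)) => // [||i ir|].
- by rewrite aE -(qc' 0%N) // ltnW.
- by rewrite bE -(qc' 1%N).
- by have := kE (Ordinal ir); rewrite tnth_mktuple.
- by rewrite -addn2 subnK.
Qed.

Lemma Kset_even r (c : r.-tuple nat) : (2 <= r)%N ->
  first_parities c = (false, false) -> Kset c 2 = set0.
Proof.
move=> r2 c_even; rewrite -subset0 => k [_ [Q [a [b [_ /lattice_ptP pair_ab _ qc]]]]].
have [/eqP] := (congr_qseq_Kset c r2 pair_ab).1 qc; rewrite c_even => -[aE bE] _.
by case/andP: pair_ab => _ /coprime_odd; rewrite aE bE.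
Qed.

Lemma lattice_count_congr_qseq Q r (c : r.-tuple nat) : (2 <= r)%N ->
  lattice_count Q [rel a b | farey_pair Q a b && `[< congr_mod 2 (qseq Q a b) c >]] =
  lattice_count Q [rel a b | [&& farey_pair Q a b, parity_class (first_parities c) a b &
    `[< Kset c 2 (kseq_tuple (r - 2) Q a b) >]]].
Proof.
move=> r2; apply: eq_lattice_count => a b _ _; apply: andb_id2l => pair_ab.
apply/asboolP/andP => [/(congr_qseq_Kset c r2 pair_ab)[e_ab Kc]|[e_ab /asboolP Kc]].
  by split=> //; exact/asboolP.
exact/(congr_qseq_Kset c r2 pair_ab).
Qed.

Lemma farey_count_pairs d Q r (c : r.-tuple nat) : (2 <= r)%N ->
  let pairs := lattice_count Q
    [rel a b | farey_pair Q a b && `[< congr_mod d (qseq Q a b) c >]] in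
  (farey_count Q c d <= pairs <= farey_count Q c d + r)%N.
Proof.
move=> r2; rewrite /= -(count_farey_pairs Q [rel a b | `[< congr_mod d (qseq Q a b) c >]]).
set n := size (farey Q).
have -> : farey_count Q c d =
    count (fun i => `[< congr_mod d (qseq Q (farey_denom Q i) (farey_denom Q i.+1)) c >])
      (iota 0 (n - (r - 1))).
  apply: eq_in_count => i; rewrite mem_iota add0n => /andP[_ i_lt].
  have denomE (j : 'I_r) : nth 0%N (farey_den Q) (i + j) =
      qseq Q (farey_denom Q i) (farey_denom Q i.+1) j.
    have := ltn_ord j; rewrite -/(farey_denom Q (i + j)) => jr.
    by apply: farey_denom_qseq; rewrite -/n; lia.
  by apply: asbool_equiv_eq; split=> qc j; have := qc j; rewrite denomE.
have -> : n.-1 = ((n - (r - 1)) + (n.-1 - (n - (r - 1))))%N by lia.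
rewrite iotaD count_cat leq_addr leq_add2l.
by apply: leq_trans (count_size _ _) _; rewrite size_iota; lia.
Qed.

Lemma farey_count1 d Q (c : 1.-tuple nat) :
  let pairs := lattice_count Q
    [rel a b | farey_pair Q a b && (a == tnth c ord0 %[mod d])] in
  (pairs <= farey_count Q c d <= pairs.+1)%N.
Proof.
rewrite /= -(count_farey_pairs Q [rel a _ | a == tnth c ord0 %[mod d]]).
have -> : farey_count Q c d =
    count (fun i => farey_denom Q i == tnth c ord0 %[mod d]) (iota 0 (size (farey Q))).
  rewrite /farey_count subn0; apply: eq_count => i; apply/asboolP/eqP => [/(_ ord0)|qc j].
    by rewrite addn0.
  by rewrite ord1 addn0.
case: (size (farey Q)) => [|n]; first by [].
rewrite -[in iota 0 n.+1]addn1 iotaD count_cat leq_addr /=.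
by case: (_ == _); lia.
Qed.

(** * Limits of the densities *)

Section Limits.
Variable R : realType.
Local Notation mu := (@lebesgue_measure R \x @lebesgue_measure R)%E.
Local Notation kappa := (parity_density R).

Lemma cvg_farey_pair_parity_density e : e != (false, false) ->
  lattice_density R Q [rel a b | farey_pair Q a b && parity_class e a b]
    @[Q --> \oo] --> kappa / 2.
Proof.
move=> /(@cvg_region_parity_density R 0 setT); rewrite region_setT area_fareyT /=.
under eq_cvg => Q.
  rewrite /lattice_density; under eq_lattice_count do rewrite /= asboolT // andbT.
  over.
exact.
Qed.

Lemma size_farey Q : (0 < Q)%N ->
  size (farey Q) = (\sum_(e | e != (false, false))
    lattice_count Q [rel a b | farey_pair Q a b && parity_class e a b]).+1.
Proof.
move=> /size_farey_gt1/ltnW/prednK <-; congr _.+1.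
rewrite -(size_iota 0 (size _).-1) -count_predT (count_farey_pairs Q [rel _ _ | true]).
rewrite lattice_count_parity => [|a b /andP[/andP[]] //]; apply: eq_bigr => e _.
by apply: eq_lattice_count => a b _ _; rewrite /= andbT.
Qed.

Lemma cvg_size_farey (x : R) :
  ((size (farey Q))%:R - x) / Q%:R ^+ 2 @[Q --> \oo] --> 3 / 2 * kappa.
Proof.
have sum_density := cvgn_sum (s := index_enum (bool * bool)%type)
  (fun e => @cvg_farey_pair_parity_density e).
have rest := @cvg_div_sqr_bounded R (fun=> 1 - x) `|1 - x| (fun=> lexx _).
have -> : 3 / 2 * kappa = \sum_(e : bool * bool | e != (false, false)) (kappa / 2) + 0.
  by rewrite addr0 sumr_const cardC1 card_prod card_bool /=; field.
apply: cvg_trans (cvgD sum_density rest); apply: near_eq_cvg; near=> Q.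
have Q0 : (0 < Q)%N by near: Q; exact: nbhs_infty_gt.
by rewrite /= size_farey // -natr1 natr_sum -addrA mulrDl mulr_suml.
Unshelve. all: by end_near. Qed.

Lemma cvg_rhoQ d r (c : r.-tuple nat) (S : nat -> rel nat) (l C : R) :
  (forall Q, `|(farey_count Q c d)%:R - (lattice_count Q (S Q))%:R| <= C) ->
  lattice_density R Q (S Q) @[Q --> \oo] --> l ->
  rhoQ R c d Q @[Q --> \oo] --> l / (3 / 2 * kappa).
Proof.
move=> count_near S_density; have k0 := parity_density_gt0 R.
have size_limit0 : 3 / 2 * kappa != 0 by rewrite gt_eqF // mulr_gt0 // divr_gt0.
rewrite -[l]addr0; apply: cvg_trans (cvgM (cvgD S_density (cvg_div_sqr_bounded count_near))
  (cvgV size_limit0 (cvg_size_farey (r%:R - 1)))); apply: near_eq_cvg; near=> Q.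
have Q0 : Q%:R ^+ 2 != 0 :> R.
  by rewrite expf_neq0 // pnatr_eq0 -lt0n; near: Q; exact: nbhs_infty_gt.
rewrite /= /lattice_density -mulrDl addrC subrK /rhoQ.
by rewrite invf_div mulrA divfK.
Unshelve. all: by end_near. Qed.

Lemma cvg_congr_qseq_density r (c : r.-tuple nat) : (2 <= r)%N ->
  lattice_density R Q [rel a b | farey_pair Q a b && `[< congr_mod 2 (qseq Q a b) c >]]
    @[Q --> \oo] -->
  kappa * fine (mu (region R (Kset c 2))).
Proof.
move=> r2; have [c_even|c_odd] := eqVneq (first_parities c) (false, false).
  have K0 := Kset_even r2 c_even.
  have region0 : region R (Kset c 2) = set0 by rewrite K0; apply/seteqP; split=> p // -[].
  rewrite (_ : kappa * _ = 0); last by rewrite region0 measure0 mulr0.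
  under eq_cvg => Q.
    rewrite /lattice_density lattice_count_congr_qseq // lattice_count0 ?mul0r; last first.
      by move=> a b _ _; rewrite /= [`[< _ >]]asboolF ?andbF // K0.
    over.
  exact: cvg_cst.
under eq_cvg do rewrite /lattice_density lattice_count_congr_qseq //.
exact: cvg_region_parity_density.
Qed.

Lemma cvg_rhoQ_ge2 r (c : r.-tuple nat) : (2 <= r)%N ->
  rhoQ R c 2 Q @[Q --> \oo] --> 2 / 3 * fine (mu (region R (Kset c 2))).
Proof.
move=> r2; have k0 := parity_density_gt0 R.
have -> : 2 / 3 * fine (mu (region R (Kset c 2))) =
    (kappa * fine (mu (region R (Kset c 2)))) / (3 / 2 * kappa).
  by field; rewrite gt_eqF.
apply: (cvg_rhoQ (C := r%:R) _ (cvg_congr_qseq_density r2)) => Q.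
have /andP[count_le le_count] := farey_count_pairs 2 Q c r2.
by rewrite distrC ger0_norm ?subr_ge0 ?ler_nat // lerBlDl -natrD ler_nat.
Qed.

Lemma lattice_count_first_parity Q (o : bool) :
  lattice_count Q [rel a b | farey_pair Q a b && (odd a == o)] =
  (\sum_(e | (e != (false, false)) && (e.1 == o))
    lattice_count Q [rel a b | farey_pair Q a b && parity_class e a b])%N.
Proof.
rewrite lattice_count_parity => [|a b /andP[/andP[]] //].
rewrite [RHS]big_mkcondr; apply: eq_bigr => -[e1 e2] _ /=.
case: ifP => [/eqP <-|e1o].
  apply: eq_lattice_count => a b _ _; rewrite /parity_class /= -andbA xpair_eqE.
  by case: (odd a == e1).
apply: lattice_count0 => a b _ _; rewrite /parity_class /= -andbA xpair_eqE.
by case: (odd a =P e1) => [->|]; rewrite ?e1o ?andbF.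
Qed.

Lemma cvg_first_parity_density (o : bool) :
  lattice_density R Q [rel a b | farey_pair Q a b && (odd a == o)]
    @[Q --> \oo] --> o.+1%:R * (kappa / 2).
Proof.
have -> : o.+1%:R * (kappa / 2) =
    \sum_(e : bool * bool | (e != (false, false)) && (e.1 == o)) (kappa / 2).
  transitivity (\sum_(e1 : bool) \sum_(e2 : bool)
      if ((e1, e2) != (false, false)) && (e1 == o) then kappa / 2 else 0).
    by rewrite !big_bool; case: o => /=; field.
  by rewrite pair_bigA [RHS]big_mkcond; apply: eq_bigr => -[].
under eq_cvg do rewrite /lattice_density lattice_count_first_parity natr_sum mulr_suml.
by apply: cvgn_sum => e /andP[e0 _]; exact: cvg_farey_pair_parity_density.
Qed.

Lemma cvg_rhoQ1 (c : 1.-tuple nat) :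
  rhoQ R c 2 Q @[Q --> \oo] --> ((odd (tnth c ord0)).+1%:R / 3 : R).
Proof.
have k0 := parity_density_gt0 R; set o := odd _.
have -> : o.+1%:R / 3 = o.+1%:R * (kappa / 2) / (3 / 2 * kappa) by field; rewrite gt_eqF.
apply: (cvg_rhoQ (C := 1) _ (@cvg_first_parity_density o)) => Q.
have /andP[le_count count_le] := farey_count1 2 Q c.
rewrite -(@eq_lattice_count _ [rel a b | farey_pair Q a b && (a == tnth c ord0 %[mod 2])]).
  by rewrite ger0_norm ?subr_ge0 ?ler_nat // lerBlDr nat1r ler_nat.
by move=> a b _ _; rewrite /= eqn_mod2_odd.
Qed.

Lemma fine_area_fareyT : 2 / 3 * fine (mu (@fareyT R)) = 1 / 3 :> R.
Proof. by rewrite area_fareyT /=; field. Qed.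

Lemma region_Kset_pair d (c : 2.-tuple nat) Q a b : lattice_pt Q a b ->
  congr_mod d (qseq Q a b) c -> region R (Kset c d) = @fareyT R.
Proof.
move=> /lattice_ptP pair_ab qc; have Kc := Kset_kseq_tuple pair_ab qc.
apply/seteqP; split=> p; [by case|move=> Tp; split=> //].
by rewrite (tuple0 (kidx_tuple _ p)) -(tuple0 (kseq_tuple (2 - 2) Q a b)).
Qed.

Lemma rho_pair (c : 2.-tuple nat) Q a b : lattice_pt Q a b ->
  congr_mod 2 (qseq Q a b) c -> rho R c 2 = 1 / 3.
Proof.
move=> lat qc; rewrite /rho (cvg_lim _ (@cvg_rhoQ_ge2 2 c isT)) //.
by rewrite (region_Kset_pair lat qc) fine_area_fareyT.
Qed.

End Limits.

Theorem theorem4 (R : realType) :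
  (forall (r : nat) (c : r.-tuple nat), (1 <= r)%N ->
     (forall j : 'I_r, (tnth c j < 2)%N) -> cvgn (rhoQ R c 2)) /\
  (rho R [tuple 0%N] 2 = 1 / 3 /\ rho R [tuple 1%N] 2 = 2 / 3) /\
  (rho R [tuple 0%N; 1%N] 2 = 1 / 3 /\ rho R [tuple 1%N; 0%N] 2 = 1 / 3 /\
   rho R [tuple 1%N; 1%N] 2 = 1 / 3) /\
  (forall (r : nat) (c : r.-tuple nat), (3 <= r)%N ->
     (forall j : 'I_r, (tnth c j < 2)%N) ->
     ((rho R c 2)%:E = (2 / 3)%:E * \esum_(k in Kset c 2) area (fareyTk R k))%E).
Proof.
split; [|split; [|split]].
- move=> [//|[|r]] c _ _; apply/cvg_ex; eexists; first exact: cvg_rhoQ1.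
  exact: cvg_rhoQ_ge2.
- by split; rewrite /rho (cvg_lim _ (@cvg_rhoQ1 R _)).
- split; [|split].
  + by apply: (@rho_pair R _ 2 2 1) => // -[[|[|]]].
  + by apply: (@rho_pair R _ 2 1 2) => // -[[|[|]]].
  + by apply: (@rho_pair R _ 1 1 1) => // -[[|[|]]].
- move=> r c r3 _; rewrite /rho (cvg_lim _ (@cvg_rhoQ_ge2 R r c (ltnW r3))) //.
  rewrite EFinM fineK -?area_region //.
  by apply: fin_num_area; [exact: measurable_region|exact: region_sub].
Qed.
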